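(* Let $n\ge2$, $\lambda>2$ and $\varphi\in\mathfrak{diff}^{1,+}_{\mathbb R^n}(C_\lambda^n)$. Then there is a covering of $C_\lambda^n$ by a finite collection of disjoint standard parallelepipeds $\{I_j\}$, integers $k_{j,i}\in\mathbb Z$, points $a_{j,i},b_{j,i}\in C_\lambda$ ($1\le i\le n$) and orientation preserving symmetries $S_j$ of the cube such that, for any $x\in I_j\cap C_\lambda^n$, $$\varphi(x)=A_j(S_j(x)),\qquad A_j(y_1,\ldots,y_n)=\bigl(b_{j,i}+\lambda^{k_{j,i}}(y_i-a_{j,i})\bigr)_{i=1,\ldots,n}.$$ In particular, $\mathfrak{diff}^{1,+}_{\mathbb R^n}(C_\lambda^n)$ is isomorphic to the $n$-dimensional Brin group $nV^{sym}$ decorated by the group $D_n$ of orientation preserving symmetries of the cube.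
   Context: For $\lambda>2$, $C_\lambda\subset[0,1]$ is the central Cantor set, the attractor of $\phi_0(x)=\frac1\lambda x$, $\phi_1(x)=\frac1\lambda x+\frac{\lambda-1}\lambda$, i.e. the unique nonempty compact set with $C_\lambda=\phi_0(C_\lambda)\cup\phi_1(C_\lambda)$; $C_\lambda^n\subset\mathbb R^n$ is the product of $n$ copies of $C_\lambda$. Standard intervals are the images of $[0,1]$ under the monoid generated by $\phi_0,\phi_1$; standard parallelepipeds are products of $n$ standard intervals. $\mathfrak{diff}^{1,+}_{\mathbb R^n}(C)$ is the group of transformations of $C$ that arise as restrictions to $C$ of orientation preserving $\mathcal C^1$-diffeomorphisms of $\mathbb R^n$ sending $C$ to itself. $D_n$ is the group of orientation preserving symmetries of the cube $[0,1]^n$ (isomorphic to the group of orthogonal $n\times n$ integer matrices of determinant $1$). The group $nV^{sym}$: a numbered pattern is a finite dyadic partition of the unit cube into parallelepipeds, obtained from the cube by dividing at each step one parallelepiped into two equal halves by a hyperplane parallel to a coordinate hyperplane, together with a numbering. Let $K\subset[0,1]$ be the standard triadic Cantor set. A pattern $P=(L_1,\ldots,L_N)$ determines a partition of $K^n$ into clopen sets $A(L_1),\ldots,A(L_N)$, where halving a parallelepiped in a coordinate direction corresponds to cutting the corresponding piece of $K^n$ by removing the middle third in this direction; each $A(L_i)$ is the image of $K^n$ under a unique affine map $\alpha_{L_i}$ that is increasing in each coordinate and preserves coordinate directions. Given patterns $P=(L_1,\ldots,L_N)$, $Q=(R_1,\ldots,R_N)$ and $\Sigma=(\sigma_1,\ldots,\sigma_N)\in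 D_n^N$, let $h_{P,Q,\Sigma}$ be the homeomorphism of $K^n$ equal to $\alpha_{R_i}\circ\sigma_i\circ\alpha_{L_i}^{-1}$ on $A(L_i)$. $nV^{sym}$ is the group of all homeomorphisms of $K^n$ of the form $h_{P,Q,\Sigma}$. *)

(* Defs.v *)
From HB Require Import structures.
From mathcomp Require Import all_boot all_order all_algebra.
From mathcomp Require Import all_classical all_reals all_analysis.

Set Implicit Arguments.
Unset Strict Implicit.
Unset Printing Implicit Defensive.

Import Order.TTheory GRing.Theory Num.Theory.
Import numFieldNormedType.Exports.

Local Open Scope classical_set_scope.
Local Open Scope ring_scope.

Definition transformation_group (T : Type) (G : set (T -> T)) : Prop :=
  [/\ G idfun,
      forall f g, G f -> G g -> G (f \o g) &
      forall f, G f -> exists g, [/\ G g, cancel f g & cancel g f]].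

Definition isomorphic_groups (T U : Type) (G : set (T -> T))
    (H : set (U -> U)) : Prop :=
  [/\ transformation_group G, transformation_group H &
      exists F : (T -> T) -> (U -> U),
        set_bij G H F /\
        forall f g, G f -> G g -> F (f \o g) = F f \o F g].

Section Cantor.
Context {R : realType}.
Implicit Types (lambda : R) (n : nat).

(* [phi lambda false] is phi_0 and [phi lambda true] is phi_1. *)
Definition phi lambda (b : bool) (x : R) : R :=
  lambda^-1 * x + (if b then (lambda - 1) / lambda else 0).

Definition is_cantor lambda (C : set R) : Prop :=
  [/\ C !=set0, compact C &
      C = (phi lambda false @` C) `|` (phi lambda true @` C)].

(* For 2 < lambda exactly one set satisfies [is_cantor lambda], so the default
   value set0 is irrelevant. *)
Definition cantor lambda : set R := xget set0 [set C | is_cantor lambda C].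

(* The element phi_{w_1} \o ... \o phi_{w_m} of the monoid. *)
Definition phi_word lambda (w : seq bool) : R -> R :=
  foldr (fun b f => phi lambda b \o f) idfun w.

Definition standard_interval lambda (J : set R) : Prop :=
  exists w : seq bool, J = phi_word lambda w @` [set` `[0, 1]].

Definition box n (J : 'I_n -> set R) : set 'rV[R]_n :=
  [set x | forall i, J i (x ord0 i)].

Definition standard_parallelepiped lambda n (B : set 'rV[R]_n) : Prop :=
  exists J : 'I_n -> set R,
    (forall i, standard_interval lambda (J i)) /\ B = box J.

Definition cantor_power lambda n : set 'rV[R]_n := box (fun=> cantor lambda).

End Cantor.

Arguments cantor_power {R} lambda n _.

Section Diffeomorphisms.
Context {R : realType} {n : nat}.
Implicit Types (f g Phi : 'rV[R]_n -> 'rV[R]_n).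

Definition C1 f : Prop :=
  (forall x, differentiable f x) /\ continuous (jacobian f).

Definition C1_diffeo f : Prop :=
  exists g, [/\ cancel f g, cancel g f, C1 f & C1 g].

Definition orientation_preserving f : Prop :=
  forall x, 0 < \det (jacobian f x).

Definition diff1p (C : set 'rV[R]_n) : set (C -> C) :=
  [set varphi | exists Phi,
    [/\ C1_diffeo Phi, orientation_preserving Phi, Phi @` C = C &
        forall x : C, val (varphi x) = Phi (val x)]].

Definition unit_cube : set 'rV[R]_n := box (fun=> [set` `[0, 1]]).

(* An isometry of Euclidean R^n is an orthogonal map followed by a
   translation; points are row vectors, whence x *m M. *)
Definition cube_symmetry (S : 'rV[R]_n -> 'rV[R]_n) : Prop :=
  exists (M : 'M[R]_n) (v : 'rV[R]_n),
    [/\ M *m M^T = 1%:M, \det M = 1,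
        forall x, S x = x *m M + v & S @` unit_cube = unit_cube].

End Diffeomorphisms.

Arguments diff1p {R n} C _.

(* The dyadic subinterval phi_word 2 w @` [0, 1] of [0, 1] is encoded by the
   word w; its left and right halves are then [rcons w false] and
   [rcons w true].  A dyadic parallelepiped is encoded by its n edges. *)
Notation dyadic_box n := {ffun 'I_n -> seq bool}.

Definition half_box (n : nat) (L : dyadic_box n) (i : 'I_n) (b : bool) :
    dyadic_box n :=
  [ffun j => if j == i then rcons (L j) b else L j].

(* The numbering of a pattern is the order of the list. *)
Inductive pattern (n : nat) : seq (dyadic_box n) -> Prop :=
| pattern_cube : pattern [:: [ffun=> [::]]]
| pattern_halve P1 L P2 (i : 'I_n) :
    pattern (P1 ++ L :: P2) ->
    pattern (P1 ++ half_box L i false :: half_box L i true :: P2)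
| pattern_renumber P Q : perm_eq P Q -> pattern P -> pattern Q.

Section BrinGroup.
Context (R : realType) (n : nat).

Definition triadic_power : set 'rV[R]_n := cantor_power 3 n.

(* alpha_L is increasing in each coordinate; A(L) is
   [alpha L @` triadic_power].  Replacing 3 by 2 gives the affine map sending
   the unit cube onto the dyadic parallelepiped L. *)
Definition alpha (L : dyadic_box n) (x : 'rV[R]_n) : 'rV[R]_n :=
  \row_i phi_word 3 (L i) (x ord0 i).

(* f = h_{P,Q,Sigma}: on A(L_i) it is alpha_{R_i} \o sigma_i \o alpha_{L_i}^-1,
   which is expressed by parametrizing A(L_i) by alpha_{L_i}.  The A(L_i), and
   likewise the A(R_i), form a clopen partition of K^n, so f is automatically
   a homeomorphism. *)
Definition nVsym : set (triadic_power -> triadic_power) :=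
  [set f | exists (N : nat) (P Q : N.-tuple (dyadic_box n))
                  (Sigma : 'I_N -> 'rV[R]_n -> 'rV[R]_n),
    [/\ pattern P, pattern Q, forall i, cube_symmetry (Sigma i) &
        forall (i : 'I_N) (x y : triadic_power),
          val x = alpha (tnth P i) (val y) ->
          val (f x) = alpha (tnth Q i) (Sigma i (val y))]].

End BrinGroup.

Arguments nVsym R n _ : clear implicits.

(* Main.v *)
Require Import Defs.
From mathcomp Require Import all_boot all_order all_algebra all_fingroup.
From mathcomp Require Import all_classical all_reals all_analysis.
From mathcomp Require Import ring lra zify.
Import Order.TTheory GRing.Theory Num.Theory.
Import numFieldNormedType.Exports.
Local Open Scope classical_set_scope.
Local Open Scope ring_scope.
Set Implicit Arguments.
Unset Strict Implicit.
Unset Printing Implicit Defensive.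

(** Why the theorem holds.

    Rigidity.  Let Phi be a C1 diffeomorphism preserving the Cantor set C^n.  At
    a corner p of a standard cube, C^n spans an orthant; its image under the
    differential is the tangent cone at q = Phi p, which is squeezed between the
    coordinate half-axes along which C^n clusters at q.  Hence, up to signs, the
    Jacobian and its inverse are both nonnegative matrices, so the Jacobian is
    monomial ([monomial_at_corner]); corners are dense and being monomial is a
    closed condition, so this holds on all of C^n ([monomial_on_cantor]).  Thus
    on a small cube Q each coordinate of Phi is, up to an error that is small
    compared with the side of Q, an affine function of a single coordinate.  A
    subset of C which is close to an affine copy of C, and which contains the
    points of C close to it, is a standard piece of C, because its largest gap
    must be the gap of that piece ([affine_copy]).  Applied to the projections of
    Phi(Q) this shows that Phi(Q) is a standard parallelepiped.  Applied to the
    subcubes of Q of all depths it shows that Phi acts on the digits of the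
    coordinates of Q by a signed permutation of the axes ([target_child],
    [target_error]), that is, Phi is exactly affine on Q ([rigid_in_region]).
    Compactness makes the depth of Q uniform ([rigid_uniform]), which gives the
    first assertion.

    From diffeomorphisms to patterns.  The cubes of a uniform grid form a
    pattern, but their images need not, so both are refined: halving a cube
    halves its image, and one halves until all images have the same depth.  The
    images are then all the cubes of a finer grid, which is a pattern
    ([sends_pattern]).

    From patterns to diffeomorphisms.  This is where n >= 2 is used.  Maps
    x + u(x_i) w, with u a C1 function of one variable, are diffeomorphisms when
    w_i = 0, or when w = e_i and u is nondecreasing.  As long as different pieces
    are told apart by some coordinate, such maps move them independently.  By
    induction on its construction, the boxes of a pattern can be carried, each by
    the inverse of its affine parametrization, onto unit cubes placed along the
    diagonal ([pattern_spread]).  There each cube can be rotated alone, a quarter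
    turn being a product of three shears ([realizable_quarter_turn]), and quarter
    turns generate the orientation preserving symmetries of the cube.  Spreading
    the source pattern, rotating, and gathering the target pattern realizes any
    element of nV^sym ([pattern_realize]).

    Finally C_lambda and the triadic Cantor set are conjugate by the map that
    preserves digits, and conjugation by its n-th power is the isomorphism. *)

(** * Words, digits and coding of a central Cantor set *)

Section CantorCode.
Context {R : realType} (lambda : R) (hl : 2 < lambda).
Implicit Types (x y : R) (b : bool) (w : seq bool) (s : nat -> bool).
Local Notation C := (cantor lambda).

Lemma lam_gt0 : 0 < lambda. Proof. by move: hl; lra. Qed.
Lemma lam_neq0 : lambda != 0. Proof. by rewrite gt_eqF ?lam_gt0. Qed.
Lemma lamV_gt0 : 0 < lambda^-1. Proof. by rewrite invr_gt0 lam_gt0. Qed.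
Lemma lamV_lt : lambda^-1 < 2^-1.
Proof. by rewrite ltf_pV2 ?posrE ?lam_gt0. Qed.

Lemma phiE b x : phi lambda b x = lambda^-1 * x + (1 - lambda^-1) *+ b.
Proof. by rewrite /phi; case: b => //=; rewrite mulrBl mulfV ?lam_neq0// mul1r. Qed.

Lemma phi_onem b x : phi lambda (~~ b) (1 - x) = 1 - phi lambda b x.
Proof. by rewrite !phiE; case: b => /=; rewrite ?mulr1n ?mulr0n; ring. Qed.

(** * Existence of the central Cantor set *)

(** Membership is tested with the expanding branches, so that closedness is
    inherited by preimages. *)
Fixpoint approx (m : nat) : set R :=
  if m is m'.+1
  then [set x | approx m' (lambda * x) \/ approx m' (lambda * x - (lambda - 1))]
  else [set x | 0 <= x <= 1].

Lemma approx01 m x : approx m x -> 0 <= x <= 1.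
Proof.
have l0 := lam_gt0; have l2 := hl.
elim: m x => //= m IH x [/IH|/IH] /andP[h1 h2].
  have x0 : 0 <= x by rewrite -(pmulr_rge0 _ l0).
  by rewrite x0 /=; nra.
by apply/andP; split; nra.
Qed.

Lemma approxS m x : approx m.+1 x -> approx m x.
Proof.
elim: m x => [x /approx01//|m IH x [/IH|/IH] h]; [by left|by right].
Qed.

Lemma closed_approx m : closed (approx m).
Proof.
elim: m => [|m IH] /=.
  rewrite [X in closed X](_ : _ = [set` `[0, 1]]); first exact: interval_closed.
  by apply/seteqP; split=> x /=; rewrite in_itv.
apply: closedU.
  apply: (preimage_closed (f := fun x : R => lambda * x) _ IH) => x _.
  by apply: cvgM; [exact: cvg_cst|exact: cvg_id].
apply: (preimage_closed (f := fun x : R => lambda * x - (lambda - 1)) _ IH) => x _.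
by apply: cvgB; [apply: cvgM; [exact: cvg_cst|exact: cvg_id]|exact: cvg_cst].
Qed.

(** The intersection of the approximations is invariant because the branches
    have disjoint images: the branch used by a point is the same at all depths. *)
Lemma cantorP : is_cantor lambda C.
Proof.
apply: (@xgetPex _ set0 [set D | is_cantor lambda D]).
exists (\bigcap_m approx m); split.
- exists 0 => m _; have l0 := lam_gt0.
  by elim: m => [|m IH] /=; [rewrite lexx ler01|left; rewrite mulr0].
- apply: (subclosed_compact _ (@segment_compact _ 0 1)).
    by apply: closed_bigI => m _; exact: closed_approx.
  by move=> x /(_ 0%N I) /=; rewrite in_itv.
- have ln0 := lam_neq0; apply/seteqP; split=> x.
    move=> hx; have [x2|x2] := leP x 2^-1.
      left; exists (lambda * x); last by rewrite phiE mulKf// addr0.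
      move=> m _; have /= [//|/approx01] := hx m.+1 I.
      by have := hl; move=> ? /andP[? ?]; nra.
    right; exists (lambda * x - (lambda - 1)); last first.
      by rewrite phiE mulrBr mulKf// mulrBr mulVf// mulr1n; ring.
    move=> m _; have /= [/approx01|//] := hx m.+1 I.
    by have := hl; move=> ? /andP[? ?]; nra.
  move=> [] [y hy <-] m _; apply: approxS => /=; rewrite phiE.
    by left; rewrite addr0 mulVKf//; exact: hy.
  right; rewrite (_ : _ - _ = y); first exact: hy.
  by rewrite mulr1n mulrDr mulVKf// mulrBr mulfV// mulr1; ring.
Qed.

Lemma cantor_compact : compact C. Proof. by case: cantorP. Qed.
Lemma cantor_closed : closed C.
Proof. by apply: compact_closed; [exact: norm_hausdorff|exact: cantor_compact]. Qed.

Lemma cantor_phi b x : C x -> C (phi lambda b x).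
Proof.
by case: cantorP => _ _ E Cx; rewrite {1}E; case: b; [right|left]; exists x.
Qed.

Lemma cantor_split x : C x -> exists b y, C y /\ x = phi lambda b y.
Proof.
case: cantorP => _ _ E; rewrite {1}E => -[] [y Cy <-].
  by exists false, y.
by exists true, y.
Qed.

(** The maximum M of C satisfies phi_1 M <= M and its minimum m satisfies
    m <= phi_0 m; being themselves images under a branch pins them down. *)
Lemma cantor_extremes : [/\ C 0, C 1 & forall x, C x -> 0 <= x <= 1].
Proof.
have [C0 Cc _] := cantorP.
have cid (A : set R) : {within A, continuous (@id R)}.
  by apply: continuous_subspaceT => x; exact: cvg_id.
have [M /set_mem CM hM] := compact_EVT_max C0 Cc (cid C).
have [m /set_mem Cm hm] := compact_EVT_min C0 Cc (cid C).
have l0 := lamV_gt0; have l2 := lamV_lt.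
have {}hM x : C x -> x <= M by move=> /mem_set; exact: hM.
have {}hm x : C x -> m <= x by move=> /mem_set; exact: hm.
have M1 : M = 1.
  apply/eqP; rewrite eq_le; apply/andP; split.
    have [b [y [Cy E]]] := cantor_split CM.
    have := hM _ Cy; rewrite E phiE; case: b {E} => /=; rewrite ?mulr1n ?mulr0n; last first.
      have := hM _ Cm; have := hM _ (cantor_phi true CM); rewrite phiE mulr1n.
      by nra.
    by have := hM _ (cantor_phi true CM); rewrite phiE mulr1n; nra.
  by have := hM _ (cantor_phi true CM); rewrite phiE mulr1n; nra.
have m0 : m = 0.
  apply/eqP; rewrite eq_le; apply/andP; split.
    by have := hm _ (cantor_phi false Cm); rewrite phiE mulr0n; nra.
  have [b [y [Cy E]]] := cantor_split Cm.
  have := hm _ Cy; rewrite E phiE; case: b {E} => /=; rewrite ?mulr1n ?mulr0n; nra.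
by split=> [||x Cx]; [rewrite -m0|rewrite -M1|rewrite -{1}m0 -M1 hM// hm].
Qed.

Lemma cantor0 : C 0. Proof. by case: cantor_extremes. Qed.
Lemma cantor1 : C 1. Proof. by case: cantor_extremes. Qed.
Lemma cantor_ge0 x : C x -> 0 <= x.
Proof. by case: cantor_extremes => _ _ h /h/andP[]. Qed.
Lemma cantor_le1 x : C x -> x <= 1.
Proof. by case: cantor_extremes => _ _ h /h/andP[]. Qed.

(** * Words *)

Lemma phi_word_cat u w x :
  phi_word lambda (u ++ w) x = phi_word lambda u (phi_word lambda w x).
Proof. by elim: u => //= b u IH; rewrite IH. Qed.

Lemma phi_word_rcons u b x :
  phi_word lambda (rcons u b) x = phi_word lambda u (phi lambda b x).
Proof. by rewrite -cats1 phi_word_cat. Qed.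

Lemma phi_wordE w x :
  phi_word lambda w x = lambda^-1 ^+ size w * x + phi_word lambda w 0.
Proof.
elim: w => [|b w IH] /=; first by rewrite expr0 mul1r addr0.
by rewrite IH !phiE mulrDr exprS mulrA addrA.
Qed.

Lemma phi_wordB w x y : phi_word lambda w x - phi_word lambda w y =
  lambda^-1 ^+ size w * (x - y).
Proof. by rewrite phi_wordE [X in _ - X]phi_wordE; ring. Qed.

Lemma lamVX_gt0 m : 0 < lambda^-1 ^+ m.
Proof. by rewrite exprn_gt0 ?lamV_gt0. Qed.

Lemma phi_word_inj w : injective (phi_word lambda w).
Proof.
move=> x y /eqP; rewrite -subr_eq0 phi_wordB mulf_eq0 gt_eqF ?lamVX_gt0//= subr_eq0.
by move/eqP.
Qed.

Lemma phi_word_onem w x :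
  phi_word lambda (map negb w) (1 - x) = 1 - phi_word lambda w x.
Proof. by elim: w => //= b w ->; rewrite phi_onem. Qed.

Lemma phi01 b x : 0 <= x <= 1 -> 0 <= phi lambda b x <= 1.
Proof.
have l0 := lamV_gt0; have l2 := lamV_lt.
by rewrite phiE; case: b => /=; rewrite ?mulr1n ?mulr0n => /andP[? ?]; apply/andP; split; nra.
Qed.

Lemma phi_word01 w x : 0 <= x <= 1 -> 0 <= phi_word lambda w x <= 1.
Proof. by elim: w => //= b w IH /IH /phi01. Qed.

Lemma cantor_word w x : C x -> C (phi_word lambda w x).
Proof. by elim: w => //= b w IH /IH /cantor_phi. Qed.

Lemma phi_sep b x y : 0 <= x <= 1 -> 0 <= y <= 1 ->
  1 - 2 * lambda^-1 <= `|phi lambda b x - phi lambda (~~ b) y|.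
Proof.
move=> /andP[x0 x1] /andP[y0 y1]; have l0 := lamV_gt0; have l2 := lamV_lt.
rewrite !phiE; case: b => /=; rewrite ?mulr1n ?mulr0n.
  by apply: (le_trans _ (ler_norm _)); nra.
by rewrite distrC; apply: (le_trans _ (ler_norm _)); nra.
Qed.

(** At the first place where the words differ the intervals lie on the two
    sides of a gap of length (lambda - 2) / lambda^j, with j at most their
    common length. *)
Lemma phi_word_sep w w' x y : size w = size w' -> w <> w' ->
  0 <= x <= 1 -> 0 <= y <= 1 ->
  (lambda - 2) * lambda^-1 ^+ size w <=
    `|phi_word lambda w x - phi_word lambda w' y|.
Proof.
elim: w w' => [|b w IH] [|b' w']//= [sz] ne hx hy; have l0 := lamV_gt0.
have := eqVneq b b' => -[E|bb'].
  have hB (p q k : R) : lambda^-1 * p + k - (lambda^-1 * q + k) = lambda^-1 * (p - q).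
    by ring.
  rewrite !phiE -E hB normrM (gtr0_norm l0).
  rewrite exprS mulrCA ler_pM2l//; apply: IH => // E'.
  by apply: ne; rewrite E E'.
have -> : b' = ~~ b by case: (b) (b') bb' => -[].
apply: le_trans (phi_sep _ (phi_word01 _ hx) (phi_word01 _ hy)).
have -> : 1 - 2 * lambda^-1 = (lambda - 2) * lambda^-1.
  by rewrite mulrBl mulfV// lam_neq0.
rewrite exprS mulrA ler_piMr//.
  by rewrite mulr_ge0 ?(ltW l0)//; move: hl; lra.
by apply: exprn_ile1; [exact: ltW|have := lamV_lt; lra].
Qed.

(** * Digits *)

(** The point 1/2 lies in the central gap of C. *)
Definition digit x : bool := 2^-1 < x.
Definition shift x : R := lambda * x - (lambda - 1) *+ digit x.
Definition code x : nat -> bool := fun m => digit (iter m shift x).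

Lemma digit_phi b x : 0 <= x <= 1 -> digit (phi lambda b x) = b.
Proof.
have l0 := lamV_gt0; have l2 := lamV_lt => /andP[? ?].
rewrite /digit phiE; case: b => /=; rewrite ?mulr1n ?mulr0n.
  by apply/idP; nra.
by apply/negbTE; rewrite -leNgt; nra.
Qed.

Lemma shift_phi b x : 0 <= x <= 1 -> shift (phi lambda b x) = x.
Proof.
move=> hx; rewrite /shift digit_phi// phiE mulrDr mulVKf ?lam_neq0//.
case: b => /=; last by rewrite !mulr0n mulr0 subr0 addr0.
by rewrite !mulr1n mulrBr mulfV ?lam_neq0// mulr1 addrK.
Qed.

Lemma cantor_shift x : C x -> C (shift x) /\ x = phi lambda (digit x) (shift x).
Proof.
move=> /cantor_split [b [y [Cy ->]]].
have hy : 0 <= y <= 1 by rewrite cantor_ge0 ?cantor_le1.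
by rewrite shift_phi ?digit_phi.
Qed.

Lemma code_phi b x : C x -> code (phi lambda b x) = fun m => if m is k.+1 then code x k else b.
Proof.
move=> Cx; have hx : 0 <= x <= 1 by rewrite cantor_ge0 ?cantor_le1.
apply/funext => -[|m]; first exact: digit_phi.
by rewrite /code iterSr shift_phi.
Qed.

Lemma cantor_prefix m x : C x -> exists2 y, C y & x = phi_word lambda (mkseq (code x) m) y.
Proof.
move=> Cx; suff [Cy E] : C (iter m shift x) /\
    x = phi_word lambda (mkseq (code x) m) (iter m shift x) by exists (iter m shift x).
elim: m => [//|m [IH1 IH2]]; have [h1 h2] := cantor_shift IH1.
by rewrite mkseqS phi_word_rcons -h2.
Qed.

(** The left end points of the nested intervals with digits s increase to the
    point they define. *)
Definition pt s : R := lim ((fun m => phi_word lambda (mkseq s m) 0) @ \oo).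

Lemma cvg_pt s : (fun m => phi_word lambda (mkseq s m) 0) @ \oo --> pt s.
Proof.
have z01 : 0 <= (0 : R) <= 1 by rewrite lexx ler01.
apply: nondecreasing_is_cvgn.
  apply/nondecreasing_seqP => m; rewrite mkseqS phi_word_rcons -subr_ge0 phi_wordB.
  rewrite subr0; apply: mulr_ge0; first by rewrite ltW ?lamVX_gt0.
  by case/andP: (phi01 (s m) z01).
exists 1 => _ [m _ <-]; by case/andP: (phi_word01 (mkseq s m) z01).
Qed.

Lemma cantor_pt s : C (pt s).
Proof.
have h : \forall m \near \oo, C (phi_word lambda (mkseq s m) 0).
  by apply: nearW => m; apply: cantor_word; exact: cantor0.
exact: (closed_cvg C cantor_closed h _ (@cvg_pt s)).
Qed.

Lemma pt_cons s : pt s = phi lambda (s 0) (pt (s \o S)).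
Proof.
apply: (cvg_unique _ (@cvg_pt s)); first exact: norm_hausdorff.
rewrite /= -cvg_shiftS.
rewrite (_ : (fun m => _) =
  fun m => phi lambda (s 0) (phi_word lambda (mkseq (s \o S) m) 0)); last first.
  by apply/funext => m; rewrite /mkseq /= -[1%N]/(1 + 0)%N iotaDl -map_comp.
by apply: cvgD; [apply: cvgM; [exact: cvg_cst|exact: cvg_pt]|exact: cvg_cst].
Qed.

Lemma code_pt s : code (pt s) = s.
Proof.
apply/funext => m; rewrite /code.
have h t : 0 <= pt t <= 1 by rewrite cantor_ge0 ?cantor_le1//; exact: cantor_pt.
have -> : iter m shift (pt s) = pt (fun k => s (m + k)%N).
  elim: m => //= m ->; rewrite pt_cons shift_phi//; congr pt.
  by apply/funext => k /=; rewrite addnS.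
by rewrite pt_cons digit_phi// addn0.
Qed.

(** Used with a the difference of two points that lie in a common interval of
    every generation. *)
Lemma small_eq0 (a B : R) : (forall m, `|a| <= B * lambda^-1 ^+ m) -> a = 0.
Proof.
move=> h; apply: contrapT => /eqP a0; have na : 0 < `|a| by rewrite normr_gt0.
have : (fun m => B * lambda^-1 ^+ m) @ \oo --> B * 0.
  apply: cvgM; first exact: cvg_cst.
  by apply: cvg_expr; rewrite gtr0_norm ?lamV_gt0//; have := lamV_lt; lra.
rewrite mulr0 => /cvgrPdist_lt /(_ _ na) [m _ /(_ m (leqnn m))] /=.
by rewrite sub0r normrN ltNge => /negP; apply; apply: le_trans (h m) (ler_norm _).
Qed.

Lemma phi_word_dist w x y : 0 <= x <= 1 -> 0 <= y <= 1 ->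
  `|phi_word lambda w x - phi_word lambda w y| <= lambda^-1 ^+ size w.
Proof.
move=> /andP[? ?] /andP[? ?]; rewrite phi_wordB normrM (gtr0_norm (lamVX_gt0 _)).
by rewrite ler_piMr ?(ltW (lamVX_gt0 _))// ler_norml; apply/andP; split; lra.
Qed.

Lemma cantor_I x : C x -> 0 <= x <= 1.
Proof. by move=> Cx; rewrite cantor_ge0 ?cantor_le1. Qed.

Lemma pt_prefix m s : exists2 y, C y & pt s = phi_word lambda (mkseq s m) y.
Proof. by have := cantor_prefix m (cantor_pt s); rewrite code_pt. Qed.

Lemma code_inj x y : C x -> C y -> code x = code y -> x = y.
Proof.
move=> Cx Cy E; apply/eqP; rewrite -subr_eq0; apply/eqP.
apply: (@small_eq0 _ 1) => m; rewrite mul1r.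
have [x' Cx' ->] := cantor_prefix m Cx; have [y' Cy' ->] := cantor_prefix m Cy.
rewrite -E -[X in _ <= _ ^+ X](size_mkseq (code x) m).
by apply: phi_word_dist; apply: cantor_I.
Qed.

Lemma pt_code x : C x -> pt (code x) = x.
Proof. by move=> Cx; apply: code_inj => //; [exact: cantor_pt|rewrite code_pt]. Qed.

Lemma pt_negb s : pt (negb \o s) = 1 - pt s.
Proof.
apply/eqP; rewrite -subr_eq0; apply/eqP; apply: (@small_eq0 _ 1) => m; rewrite mul1r.
have [y Cy ->] := pt_prefix m s; have [z Cz ->] := pt_prefix m (negb \o s).
rewrite -phi_word_onem /mkseq -map_comp.
rewrite -[X in _ <= _ ^+ X](size_mkseq (negb \o s) m); apply: phi_word_dist.
  exact: cantor_I.
by have /andP[? ?] := cantor_I Cy; apply/andP; split; lra.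
Qed.

Lemma cantor_onem x : C x -> C (1 - x).
Proof. by move=> Cx; rewrite -(pt_code Cx) -pt_negb; exact: cantor_pt. Qed.

Lemma code_onem x : C x -> code (1 - x) = negb \o code x.
Proof. by move=> Cx; rewrite -{1}(pt_code Cx) -pt_negb code_pt. Qed.

End CantorCode.

(** The digit preserving map conjugates the branches of the two iterated
    function systems ([recode_phi]); only its values on C matter. *)
Definition recode {R : realType} (lambda mu x : R) : R := pt mu (code lambda x).

Section Recode.
Context {R : realType} (lambda mu : R) (hl : 2 < lambda) (hm : 2 < mu).
Implicit Types x : R.

Lemma cantor_recode x : cantor mu (recode lambda mu x).
Proof. exact: cantor_pt. Qed.

Lemma recodeK x : cantor lambda x -> recode mu lambda (recode lambda mu x) = x.
Proof. by move=> Cx; rewrite /recode code_pt// pt_code. Qed.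

Lemma recode_phi b x : cantor lambda x ->
  recode lambda mu (phi lambda b x) = phi mu b (recode lambda mu x).
Proof. by move=> Cx; rewrite /recode pt_cons// code_phi. Qed.

Lemma recode_phi_word w x : cantor lambda x ->
  recode lambda mu (phi_word lambda w x) = phi_word mu w (recode lambda mu x).
Proof.
by move=> Cx; elim: w => //= b w <-; rewrite recode_phi//; exact: cantor_word.
Qed.

Lemma recode_onem x : cantor lambda x -> recode lambda mu (1 - x) = 1 - recode lambda mu x.
Proof. by move=> Cx; rewrite /recode code_onem// pt_negb. Qed.

End Recode.

(** * Calculus of C1 maps of R^n *)

Section MatrixNorm.
Context {R : realType} {m n : nat}.
Implicit Types (x : 'M[R]_(m, n)).

Lemma mx_entry_le x i j : `|x i j| <= `|x|.
Proof.
rewrite [leRHS]/Num.Def.normr/= mx_normrE.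
exact: (le_bigmax _ (fun ij : 'I_m * 'I_n => `|x ij.1 ij.2|) (i, j)).
Qed.

Lemma mx_norm_le x e : 0 <= e -> (forall i j, `|x i j| <= e) -> `|x| <= e.
Proof.
move=> e0 h; rewrite [leLHS]/Num.Def.normr/= mx_normrE.
by apply: bigmax_le => // -[i j] _; exact: h.
Qed.

Lemma continuous_mx (T : topologicalType) (M : T -> 'M[R]_(m, n)) :
  (forall i j, continuous (fun t => M t i j)) -> continuous M.
Proof.
move=> h t; apply/cvgrPdist_le => /= e e0.
near=> s; apply: mx_norm_le; first exact: ltW.
move=> i j; rewrite !mxE; move: i j; near: s.
apply: filter_forall => i; apply: filter_forall => j.
exact: ((cvgrPdist_le _ _).1 (h i j t)).
Unshelve. all: by end_near. Qed.

Lemma continuous_entry (T : topologicalType) (M : T -> 'M[R]_(m, n)) i j :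
  continuous M -> continuous (fun t => M t i j).
Proof.
move=> h t; apply: (@continuous_comp _ _ _ M (fun N : 'M[R]_(m, n) => N i j)).
  exact: h.
exact: coord_continuous.
Qed.

End MatrixNorm.

Lemma continuous_sumr {R : realType} (T : topologicalType) (I : Type) (r : seq I)
    (P : pred I) (F : I -> T -> R) :
  (forall i, P i -> continuous (F i)) -> continuous (fun t => \sum_(i <- r | P i) F i t).
Proof. by move=> h; apply: continuous_big => //; exact: add_continuous. Qed.

Lemma mx_norm_mulr_le {R : realType} {n p} (x : 'rV[R]_n) (M : 'M[R]_(n, p)) j :
  `|(x *m M) ord0 j| <= n%:R * (`|x| * `|M|).
Proof.
rewrite mxE; apply: le_trans (ler_norm_sum _ _ _) _.
apply: (@le_trans _ _ (\sum_(k < n) (`|x| * `|M|))); last first.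
  by rewrite sumr_const card_ord mulr_natl.
by apply: ler_sum => k _; rewrite normrM; apply: ler_pM => //; exact: mx_entry_le.
Qed.

Section C1maps.
Context {R : realType} {n : nat}.
Implicit Types (f g F : 'rV[R]_n -> 'rV[R]_n) (x y p : 'rV[R]_n).

Lemma jacobianE f x v : 'd f x v = v *m jacobian f x.
Proof. by rewrite /jacobian mul_rV_lin1. Qed.

Lemma eq_mulV (A B : 'M[R]_n) : (forall v : 'rV_n, v *m A = v *m B) -> A = B.
Proof. by move=> h; apply/row_matrixP => i; rewrite !rowE. Qed.

Lemma is_diff_coord i x : is_diff x (fun z : 'rV[R]_n => z ord0 i : R) (fun z => z ord0 i).
Proof.
have @l : {linear 'rV[R]_n -> R}.
  by exists (fun N : 'rV[R]_n => N ord0 i); do 2![eexists]; do ?[constructor];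
     rewrite ?mxE// => ? *; rewrite ?mxE//; move=> ?; rewrite !mxE.
have lc : continuous l by exact: coord_continuous.
rewrite (_ : (fun _ => _) = l) //; apply: DiffDef.
  exact/linear_differentiable.
by rewrite diff_lin.
Qed.

Lemma C1_criterion F (J : 'rV[R]_n -> 'M[R]_n) :
  (forall x, is_diff x F (fun h => h *m J x)) -> continuous J ->
  C1 F /\ jacobian F = J.
Proof.
move=> dF cJ; have E : jacobian F = J.
  apply/funext => x; apply: eq_mulV => v; rewrite -jacobianE.
  by have -> := @diff_val _ _ _ _ _ _ _ (dF x).
split=> //; split; last by rewrite E.
by move=> x; have := @ex_diff _ _ _ _ _ _ _ (dF x).
Qed.

Lemma jacobian_comp f g x : C1 f -> C1 g ->
  jacobian (f \o g) x = jacobian g x *m jacobian f (g x).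
Proof.
move=> [df _] [dg _]; apply: eq_mulV => v.
by rewrite -jacobianE diff_comp//= !jacobianE mulmxA.
Qed.

Lemma C1_continuous f : C1 f -> continuous f.
Proof. by move=> [df _] x; exact: differentiable_continuous. Qed.

Lemma C1_comp f g : C1 f -> C1 g -> C1 (f \o g).
Proof.
move=> Cf Cg; split.
  by move=> x; apply: differentiable_comp; [case: Cg|case: Cf].
rewrite (_ : jacobian _ = fun x => jacobian g x *m jacobian f (g x)); last first.
  by apply/funext => x; exact: jacobian_comp.
apply: continuous_mx => i j x.
rewrite (_ : (fun _ => _) =
  fun t => \sum_k jacobian g t i k * jacobian f (g t) k j); last first.
  by apply/funext => t; rewrite mxE.
have [[_ cf] [_ cg]] := (Cf, Cg).
have h1 k := @continuous_entry _ _ _ _ _ i k cg.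
have h2 k : continuous (fun t => jacobian f (g t) k j).
  move=> t; apply: (@continuous_comp _ _ _ g (fun z => jacobian f z k j)).
    exact: C1_continuous.
  exact: (@continuous_entry _ _ _ _ _ k j cf).
by apply: continuous_sumr => k _ z; exact: (continuousM (h1 k z) (h2 k z)).
Qed.

Lemma jacobian_id x : jacobian (idfun : 'rV[R]_n -> _) x = 1%:M.
Proof.
apply: eq_mulV => v; rewrite -jacobianE mulmx1.
by have -> := @diff_val _ _ _ _ _ _ _ (is_diff_id x).
Qed.

Lemma C1_id : C1 (idfun : 'rV[R]_n -> _).
Proof.
apply: (proj1 (C1_criterion (J := fun=> 1%:M) _ _)).
  by move=> x; rewrite (_ : (fun _ => _) = id); [exact: is_diff_id|apply/funext => h; rewrite mulmx1].
exact: cst_continuous.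
Qed.

(** By the mean value theorem along segments, continuity of the Jacobian makes
    the first order expansion uniform in both points.  This estimate is all that
    the rigidity argument uses of the C1 hypothesis. *)
Lemma C1_strict f p e : C1 f -> 0 < e ->
  exists2 r, 0 < r & forall x y, `|x - p| < r -> `|y - p| < r -> forall j,
    `|f x ord0 j - f y ord0 j - ((x - y) *m jacobian f p) ord0 j| <= e * `|x - y|.
Proof.
move=> Cf e0; have [df cJ] := Cf.
have e'0 : 0 < e / n.+1%:R by rewrite divr_gt0.
have /cvgrPdist_lt/(_ _ e'0)/nbhs_ballP[r /= r0 hr] := cJ p.
exists r => // x y xp yp j.
pose l (t : R) := y + t *: (x - y).
have dl t : is_diff t l (fun h => h *: (x - y)).
  rewrite (_ : (fun h => _) = 0 + ( *:%R^~ (x - y) : R -> 'rV[R]_n)); last first.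
    by apply/funext => h /=; rewrite fctE add0r.
  rewrite (_ : l = cst y + ( *:%R^~ (x - y) : R -> 'rV[R]_n)); last by [].
  exact: is_diffD.
pose g := (fun z : 'rV[R]_n => z ord0 j : R) \o (f \o l).
have dg t : is_diff t g (fun h => ((h *: (x - y)) *m jacobian f (l t)) ord0 j).
  have dfl : is_diff (l t) f (fun v => v *m jacobian f (l t)).
    apply: DiffDef; first exact: df.
    by apply/funext => v; rewrite jacobianE.
  exact: (@is_diff_comp _ _ _ _ _ _ _ _ _ (is_diff_comp (dl t) dfl) (is_diff_coord j _)).
have Dg t : is_derive (t : R) (1 : R) g (((x - y) *m jacobian f (l t)) ord0 j).
  have dgt := @ex_diff _ _ _ _ _ _ _ (dg t).
  apply: DeriveDef; first exact: diff_derivable.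
  by rewrite deriveE// (@diff_val _ _ _ _ _ _ _ (dg t)) scale1r.
have [c c01 E] := @MVT R g (fun t => ((x - y) *m jacobian f (l t)) ord0 j) 0 1 ltr01
  (fun t _ => Dg t) (continuous_subspaceT (fun t => differentiable_continuous
     (@ex_diff _ _ _ _ _ _ _ (dg t)))).
have {E} -> : f x ord0 j - f y ord0 j = ((x - y) *m jacobian f (l c)) ord0 j.
  by move: E; rewrite subr0 mulr1 /g /l /= scale1r scale0r addr0 subrKC.
have -> (A B : 'M[R]_n) v : (v *m A) ord0 j - (v *m B) ord0 j = (v *m (A - B)) ord0 j.
  by rewrite mulmxBr [in RHS]mxE [X in _ = _ + X]mxE.
apply: (le_trans (mx_norm_mulr_le _ _ _)).
have lc : `|l c - p| < r.
  have -> : l c - p = c *: (x - p) + (1 - c) *: (y - p).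
    by apply/matrixP => i k; rewrite /l !mxE; ring.
  move: c01; rewrite in_itv /= => /andP[c0 c1].
  apply: le_lt_trans (ler_normD _ _) _; rewrite !normrZ gtr0_norm// gtr0_norm ?subr_gt0//.
  by nra.
have := hr (l c); rewrite -ball_normE /= distrC => /(_ lc) /ltW h.
rewrite mulrCA mulrC; apply: ler_wpM2r => //; rewrite -normrN opprB.
apply: (le_trans (ler_wpM2l (ler0n _ _) h)).
by rewrite mulrCA ger_pMr// ler_pdivrMr// mul1r ler_nat.
Qed.

(** * One-variable perturbations of the identity *)

Definition C1real (u : R -> R) : Prop :=
  (forall t, derivable u t 1) /\ continuous (derive1 u).

(** A shear when w_i = 0; for w = e_i it replaces the i-th coordinate t by
    t + u t. *)
Definition push (u : R -> R) (i : 'I_n) (w x : 'rV[R]_n) : 'rV[R]_n :=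
  x + u (x ord0 i) *: w.

Lemma push_C1 u i w : C1real u ->
  C1 (push u i w) /\
  jacobian (push u i w) =
    fun x => 1%:M + derive1 u (x ord0 i) *: (delta_mx i ord0 *m w).
Proof.
move=> [du cu]; apply: C1_criterion => [x|]; last first.
  have h : continuous ((fun c => c *: (delta_mx i ord0 *m w)) \o
      (derive1 u \o (fun z : 'rV[R]_n => z ord0 i))).
    move=> x; apply: continuous_comp; last exact: scalel_continuous.
    by apply: continuous_comp; [exact: coord_continuous|exact: cu].
  by move=> x; apply: (@continuousD _ _ _ (cst 1%:M) _ x); [exact: cst_continuous|exact: h].
have dui : is_diff (x ord0 i) u (fun h => h *: derive1 u (x ord0 i)).
  by apply: DiffDef; [exact/derivable1_diffP|rewrite deriv1E].
have h := is_diff_comp (is_diff_comp (is_diff_coord i x) dui) (is_diff_scalel _ w).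
have := @is_diffD _ _ _ _ _ _ _ _ (is_diff_id x) h.
rewrite (_ : _ + _ = push u i w); last by [].
suff -> : id + (( *:%R^~ w) \o (( *:%R^~ (derive1 u (x ord0 i))) \o (fun z : 'rV[R]_n => z ord0 i))) =
  (fun h => h *m (1%:M + derive1 u (x ord0 i) *: (delta_mx i ord0 *m w))) by [].
apply/funext => v; rewrite fctE /= mulmxDr mulmx1 -scalemxAr mulmxA.
have -> : v *m delta_mx i ord0 = (v ord0 i)%:M.
  by apply/matrixP => k l; rewrite -colE !ord1 !mxE eqxx mulr1n.
by rewrite mul_scalar_mx scalerA mulrC.
Qed.

(** Only row i differs from the identity matrix, so the cofactors along that
    row are those of the identity. *)
Lemma det_push i (w : 'rV[R]_n) c :
  \det (1%:M + c *: (delta_mx i ord0 *m w)) = 1 + c * w ord0 i.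
Proof.
set A := _ + _.
have cof l : cofactor A i l = (i == l)%:R.
  transitivity (cofactor (1%:M : 'M[R]_n) i l).
    rewrite /cofactor; congr (_ * \det _); apply/matrixP => k m; rewrite !mxE.
    rewrite big1 ?mulr0 ?addr0// => p _; rewrite !mxE eq_sym.
    by rewrite (negbTE (neq_lift _ _)) mul0r.
  have := congr1 (fun B : 'M[R]_n => B l i) (@mul_mx_adj R n 1%:M).
  by rewrite mul1mx det1 !mxE eq_sym.
rewrite (expand_det_row A i) (bigD1 i)//= big1 ?addr0.
  rewrite cof eqxx mulr1 !mxE eqxx (bigD1 ord0)//= big1 ?addr0; last first.
    by move=> k; rewrite ord1.
  by rewrite !mxE !eqxx mul1r.
by move=> l li; rewrite cof eq_sym (negbTE li) mulr0.
Qed.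

(** * Orientation preserving C1 diffeomorphisms *)

Definition diffeo f : Prop := C1_diffeo f /\ orientation_preserving f.

Lemma diffeo_id : diffeo idfun.
Proof.
split; first by exists idfun; split=> //; exact: C1_id.
by move=> x; rewrite jacobian_id det1 ltr01.
Qed.

Lemma diffeo_comp f g : diffeo f -> diffeo g -> diffeo (f \o g).
Proof.
move=> [[f' [fK f'K Cf Cf']] of_] [[g' [gK g'K Cg Cg']] og]; split.
  exists (g' \o f'); split; [exact: can_comp|exact: can_comp| |]; exact: C1_comp.
by move=> x; rewrite jacobian_comp// det_mulmx mulr_gt0.
Qed.

Lemma jacobianK f g x : cancel f g -> C1 f -> C1 g ->
  jacobian f x *m jacobian g (f x) = 1%:M.
Proof.
move=> fK Cf Cg; rewrite -jacobian_comp// -(jacobian_id x).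
by congr (jacobian _ x); apply/funext => z; exact: fK.
Qed.

Lemma diffeo_inv f : diffeo f ->
  exists g, [/\ diffeo g, cancel f g & cancel g f].
Proof.
move=> [[g [fK gK Cf Cg]] of_]; exists g.
have og : orientation_preserving g; last first.
  by split; [split; [exists f|exact: og]|exact: fK|exact: gK].
move=> x; have /(congr1 determinant) := jacobianK x gK Cg Cf.
rewrite det_mulmx det1 => E.
have pos (a b : R) : 0 < b -> a * b = 1 -> 0 < a.
  by move=> b0 ab; rewrite -(pmulr_lgt0 _ b0) ab ltr01.
exact: (pos _ _ (of_ (g x)) E).
Qed.

Lemma C1real_opp u : C1real u -> C1real (fun t => - u t).
Proof.
move=> [du cu]; have dN t : derivable (fun t => - u t) t 1 by exact: derivableN.
split=> //; rewrite (_ : derive1 _ = fun t => - derive1 u t); last first.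
  by apply/funext => t; rewrite !derive1E deriveN.
by move=> t; apply: continuousN; exact: cu.
Qed.

Lemma diffeo_shear u i (w : 'rV[R]_n) : C1real u -> w ord0 i = 0 -> diffeo (push u i w).
Proof.
move=> Cu wi; split.
  exists (push (fun t => - u t) i w); split.
  - by move=> x; rewrite /push !mxE wi mulr0 addr0 scaleNr addrK.
  - by move=> x; rewrite /push !mxE wi mulr0 addr0 scaleNr subrK.
  - by case: (push_C1 i w Cu).
  - by case: (push_C1 i w (C1real_opp Cu)).
by move=> x; rewrite (proj2 (push_C1 i w Cu)) det_push wi mulr0 addr0 ltr01.
Qed.

End C1maps.

(** * Quadratic splines *)

Section Splines.
Context {R : realType}.
Implicit Types (u v du : R -> R) (a b c t : R).

Lemma C1real_criterion u du : (forall t, is_derive (t : R) (1 : R) u (du t)) ->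
  continuous du -> C1real u /\ derive1 u = du.
Proof.
move=> h cdu; have E : derive1 u = du.
  by apply/funext => t; rewrite derive1E; exact: (@derive_val _ _ _ _ _ _ _ (h t)).
split=> //; split; last by rewrite E.
by move=> t; exact: (@ex_derive _ _ _ _ _ _ _ (h t)).
Qed.

Lemma C1real_is_derive u : C1real u -> forall t, is_derive (t : R) (1 : R) u (derive1 u t).
Proof. by move=> [du _] t; rewrite derive1E; exact/derivableP. Qed.

Lemma C1real_continuous u : C1real u -> continuous u.
Proof.
by move=> [du _] t; apply/differentiable_continuous/derivable1_diffP.
Qed.

Lemma C1realD u v : C1real u -> C1real v ->
  C1real (fun t => u t + v t) /\ derive1 (fun t => u t + v t) = fun t => derive1 u t + derive1 v t.
Proof.
move=> Cu Cv; apply: C1real_criterion.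
  by move=> t; exact: (is_deriveD (C1real_is_derive Cu t) (C1real_is_derive Cv t)).
have [[_ cu] [_ cv]] := (Cu, Cv).
by move=> t; exact: (continuousD (cu t) (cv t)).
Qed.

Lemma C1realM u v : C1real u -> C1real v -> C1real (fun t => u t * v t).
Proof.
move=> Cu Cv; apply: (proj1 (C1real_criterion
    (du := fun t => u t * derive1 v t + v t * derive1 u t) _ _)).
  by move=> t; exact: (is_deriveM (C1real_is_derive Cu t) (C1real_is_derive Cv t)).
have [cu cv] := (C1real_continuous Cu, C1real_continuous Cv).
have [[_ cdu] [_ cdv]] := (Cu, Cv).
move=> t; exact: (continuousD (continuousM (cu t) (cdv t)) (continuousM (cv t) (cdu t))).
Qed.

Lemma C1real_affine a b : C1real (fun t => a * t + b) /\
  derive1 (fun t => a * t + b) = fun=> a.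
Proof.
apply: C1real_criterion; last exact: cst_continuous.
move=> t; have h1 := is_deriveZ a (is_derive_id t (1 : R)).
have := is_deriveD h1 (is_derive_cst b t 1).
by rewrite addr0 /GRing.scale /= mulr1.
Qed.

Lemma C1real_comp u v : C1real u -> C1real v ->
  C1real (fun t => u (v t)) /\
  derive1 (fun t => u (v t)) = fun t => derive1 u (v t) * derive1 v t.
Proof.
move=> Cu Cv; apply: C1real_criterion => [t|t].
  have h := is_derive1_comp (C1real_is_derive Cu (v t)) (C1real_is_derive Cv t).
  exact: h.
have [[_ cdu] [_ cdv]] := (Cu, Cv).
have h : {for t, continuous (derive1 u \o v)}.
  by apply: continuous_comp; [exact: C1real_continuous|exact: cdu].
exact: (continuousM h (cdv t)).
Qed.

Lemma C1real_sum N (u : nat -> R -> R) : (forall k, C1real (u k)) ->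
  C1real (fun t => \sum_(k < N) u k t).
Proof.
move=> h; elim: N => [|N IH].
  rewrite (_ : (fun t => _) = fun t => 0 * t + 0); first by case: (C1real_affine 0 0).
  by apply/funext => t; rewrite big_ord0 mul0r addr0.
rewrite (_ : (fun t => _) = fun t => \sum_(k < N) u k t + u N t).
  by case: (C1realD IH (h N)).
by apply/funext => t; rewrite big_ord_recr.
Qed.

(** Translates of t |t| and affine functions generate the quadratic splines. *)
Lemma derive_sq_sign t : is_derive (t : R) (1 : R) (fun s : R => s * `|s|) (2 * `|t|).
Proof.
have [t0|t0|->] := ltgtP t 0.
- apply: (@near_eq_is_derive _ _ _ (fun s : R => - (s * s))).
  + near=> s; have s0 : s < 0 by near: s; exact: lt_nbhsl.
    by rewrite ltr0_norm// mulrN.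
  + have h := is_deriveN (is_deriveM (is_derive_id t (1:R)) (is_derive_id t (1:R))).
    apply: is_derive_eq h _; rewrite /GRing.scale /= ltr0_norm//; ring.
- apply: (@near_eq_is_derive _ _ _ (fun s : R => s * s)).
  + near=> s; have s0 : 0 < s by near: s; exact: lt_nbhsr.
    by rewrite gtr0_norm.
  + have h := is_deriveM (is_derive_id t (1:R)) (is_derive_id t (1:R)).
    apply: is_derive_eq h _; rewrite /GRing.scale /= gtr0_norm//; ring.
- apply/is_derive1_caratheodory; exists (fun s : R => `|s|); split.
  + by move=> z; rewrite mul0r !subr0 mulrC.
  + exact: norm_continuous.
  + by rewrite normr0 mulr0.
Unshelve. all: by end_near. Qed.

(** Integral of a trapezoid: slope 0, then 1, then 0 again, with transitions on
    [a, a + 1] and [b, b + 1]. *)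
Lemma ramp a b : a + 1 <= b -> exists u,
  [/\ C1real u, forall t, 0 <= derive1 u t,
      forall t, t <= a -> u t = 0,
      forall t, a + 1 <= t <= b -> u t = t - (a + 2^-1) &
      forall t, b + 1 <= t -> u t = b - a].
Proof.
move=> ab; pose s (t : R) := t * `|t|.
have [Cs ds] : C1real s /\ derive1 s = fun t => 2 * `|t|.
  apply: C1real_criterion; first exact: derive_sq_sign.
  move=> t; exact: (continuousM (@cst_continuous _ _ (2 : R) t) (@norm_continuous _ _ t)).
(* The derivative of rho c is the truncation of t - c to [0, 1]. *)
pose rho c t : R := 4^-1 * s (1 * t - c) + (- 4^-1 * s (1 * t - (c + 1))
   + (2^-1 * t - (2^-1 * c + 4^-1))).
have Crho c : C1real (rho c) /\ derive1 (rho c) =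
    fun t => 2^-1 * (`|t - c| - `|t - (c + 1)| + 1).
  have [A1 E1] := C1real_affine 1 (- c).
  have [A2 E2] := C1real_affine 1 (- (c + 1)).
  have [A3 E3] := C1real_affine 2^-1 (- (2^-1 * c + 4^-1)).
  have [B1 F1] := C1real_comp Cs A1; have [B2 F2] := C1real_comp Cs A2.
  have [L1 G1] := C1real_affine 4^-1 0; have [L2 G2] := C1real_affine (- 4^-1) 0.
  have [D1 H1] := C1real_comp L1 B1; have [D2 H2] := C1real_comp L2 B2.
  have [S1 I1] := C1realD D2 A3; have [S2 I2] := C1realD D1 S1.
  rewrite (_ : rho c = fun t => (4^-1 * s (1 * t - c) + 0) +
    ((- 4^-1 * s (1 * t - (c + 1)) + 0) + (2^-1 * t - (2^-1 * c + 4^-1)))); last first.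
    by apply/funext => t; rewrite /rho !addr0.
  split=> //; rewrite I2; apply/funext => t; rewrite I1 H1 H2 E3 F1 F2 E1 E2 G1 G2 ds !mul1r.
  by lra.
have rho0 c t : t <= c -> rho c t = 0.
  by move=> tc; rewrite /rho /s !mul1r !ler0_norm; try lra; nra.
have rho1 c t : c + 1 <= t -> rho c t = t - (c + 2^-1).
  by move=> tc; rewrite /rho /s !mul1r !ger0_norm; try lra; nra.
have [Ca da] := Crho a; have [Cb db] := Crho b.
have [L1 G1] := C1real_affine (-1) 0; have [D1 H1] := C1real_comp L1 Cb.
have [S1 I1] := C1realD Ca D1.
exists (fun t => rho a t + (- 1 * rho b t + 0)); split=> //.
- move=> t; rewrite I1 H1 G1 da db.
  by have [?|?] := ger0P (t - a); have [?|?] := ger0P (t - b);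
    have [?|?] := ger0P (t - (a + 1)); have [?|?] := ger0P (t - (b + 1)); lra.
- by move=> t ta; rewrite !rho0 ?mulr0 ?addr0//; lra.
- by move=> t /andP[t1 t2]; rewrite rho1// rho0// mulr0 !addr0.
- by move=> t tb; rewrite !rho1//; lra.
Qed.

Lemma step a b : a < b -> exists u,
  [/\ C1real u, forall t, t <= a -> u t = 0 & forall t, b <= t -> u t = 1].
Proof.
move=> ab; have [u [Cu _ u0 _ u1]] := ramp (lexx (0 + 1 : R)).
have [A _] := C1real_affine (2 / (b - a)) (- (2 / (b - a) * a)).
exists (fun t => u (2 / (b - a) * t - (2 / (b - a) * a))); split.
- by case: (C1real_comp Cu A).
- by move=> t ta; apply: u0; rewrite -mulrBr mulr_ge0_le0//; [rewrite divr_ge0//; lra|lra].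
- move=> t tb; rewrite u1 ?add0r ?subr0// -mulrBr mulrAC ler_pdivlMr ?subr_gt0//; lra.
Qed.

(** Bump functions equal to 1 at distance at most 2 from 10 k vanish at
    distance 4, hence near the other multiples of 10; their combinations take
    arbitrary affine values near each multiple of 10. *)
Lemma interpolation N (p q : nat -> R) : exists2 u, C1real u &
  forall k, (k < N)%N -> forall t, `|t - 10 * k%:R| <= 2 -> u t = p k * t + q k.
Proof.
have bump (k : nat) : exists u, [/\ C1real u,
    forall t, `|t - 10 * k%:R| <= 2 -> u t = 1 &
    forall t, 4 <= `|t - 10 * k%:R| -> u t = 0].
  have [u [Cu u0 u1]] := @step (10 * k%:R - 4) (10 * k%:R - 2) ltac:(lra).
  have [v [Cv v0 v1]] := @step (10 * k%:R + 2) (10 * k%:R + 4) ltac:(lra).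
  exists (fun t => u t + - v t); split.
  - by case: (C1realD Cu (C1real_opp Cv)).
  - by move=> t; rewrite ler_norml => /andP[? ?]; rewrite u1 ?v0 ?subr0//; lra.
  - move=> t; rewrite ler_normr => /orP[h|h].
      by rewrite u1 ?v1 ?subrr//; lra.
    by rewrite u0 ?v0 ?subrr//; lra.
have [B hB] := choice bump.
exists (fun t => \sum_(k < N) B k t * (p k * t + q k)).
  apply: (@C1real_sum N (fun k t => B k t * (p k * t + q k))) => k.
  by apply: C1realM; [case: (hB k)|case: (C1real_affine (p k) (q k))].
move=> k kN t tk; rewrite (bigD1 (Ordinal kN))//= big1 ?addr0.
  by have [_ -> //] := hB k; rewrite mul1r.
move=> l lk; have [_ _ ->] := hB l; first by rewrite mul0r.
have : 10 <= `|10 * k%:R - 10 * (l : nat)%:R : R|.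
  rewrite -mulrBr normrM ger0_norm// ler_peMr//.
  have [kl|lk'|kl] := ltngtP k l.
  - by rewrite distrC -natrB 1?ltnW// normr_nat ler1n subn_gt0.
  - by rewrite -natrB 1?ltnW// normr_nat ler1n subn_gt0.
  - by move: lk; rewrite -val_eqE /= kl eqxx.
have := ler_distD t (10 * k%:R) (10 * (l : nat)%:R).
by rewrite (distrC _ t) => h1 h2; have := le_trans h2 h1; move: tk; lra.
Qed.

(** t + u t has derivative at least 1, so it is onto by the intermediate value
    theorem and its inverse is again the identity plus a C1 function. *)
Lemma C1real_inverse u : C1real u -> (forall t, 0 <= derive1 u t) ->
  exists v, [/\ C1real v, cancel (fun t => t + u t) (fun t => t + v t) &
                 cancel (fun t => t + v t) (fun t => t + u t)].
Proof.
move=> Cu u'0; have [du cdu] := Cu; have cu := C1real_continuous Cu.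
pose g t := t + u t.
have umono x y : x <= y -> u x <= u y.
  move=> xy; apply: (@ger0_derive1_le_cc _ u x y) => //.
  - exact: continuous_subspaceT.
  - by rewrite in_itv /= lexx.
  - by rewrite in_itv /= xy lexx.
have gmono x y : x < y -> g x < g y.
  by move=> xy; rewrite /g ltr_leD// umono// ltW.
have ginj : injective g.
  by move=> x y E; have [/gmono|/gmono|//] := ltgtP x y; rewrite E ltxx.
have Dg t : is_derive (t : R) (1 : R) g (1 + derive1 u t).
  exact: (is_deriveD (is_derive_id t (1 : R)) (C1real_is_derive Cu t)).
have cg : continuous g.
  move=> t; apply/differentiable_continuous/derivable1_diffP.
  exact: (@ex_derive _ _ _ _ _ _ _ (Dg t)).
have gsurj y : exists x, g x = y.
  have [uy|uy] := leP 0 (u y).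
    have := @IVT _ g (y - u y) y y; case=> //; first by lra.
    - exact: continuous_subspaceT.
    - rewrite /g; have := @umono (y - u y) y ltac:(lra) => h.
      by rewrite ge_min le_max; apply/andP; split; apply/orP; [left|right]; lra.
    - by move=> x _ <-; exists x.
  have := @IVT _ g y (y - u y) y; case=> //; first by lra.
  - exact: continuous_subspaceT.
  - rewrite /g; have := @umono y (y - u y) ltac:(lra) => h.
    by rewrite ge_min le_max; apply/andP; split; apply/orP; [left|right]; lra.
  - by move=> x _ <-; exists x.
have [h gK] := choice gsurj.
have hK : cancel g h by move=> x; apply: ginj; rewrite gK.
have n0 t : 1 + derive1 u t != 0 by rewrite gt_eqF// ltr_pwDl.
have Dh t : is_derive (t : R) (1 : R) h (1 + derive1 u (h t))^-1.
  rewrite -{1}(gK t); apply: (@is_derive_inverse _ g h (1 + derive1 u (h t)) (h t)).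
  - by near=> z; exact: hK.
  - by near=> z; exact: cg.
  - exact: n0.
have ch : continuous h.
  move=> t; apply/differentiable_continuous/derivable1_diffP.
  exact: (@ex_derive _ _ _ _ _ _ _ (Dh t)).
have [Ch _] : C1real h /\ derive1 h = (fun t => (1 + derive1 u (h t))^-1).
  apply: C1real_criterion => t.
  have c1 : {for t, continuous (derive1 u \o h)}.
    by apply: continuous_comp; [exact: ch|exact: cdu].
  have c2 := continuousD (@cst_continuous _ _ (1 : R) t) c1.
  exact: (cvgV (n0 (h t)) c2).
have [C2 _] := C1real_affine (-1) 0.
exists (fun t => h t + (- 1 * t + 0)); split.
- by case: (C1realD Ch C2).
- by move=> t; rewrite -/(g t) hK; lra.
- by move=> t; have E : t + (h t + (- 1 * t + 0)) = h t; [lra|rewrite E; exact: gK].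
Unshelve. all: by end_near. Qed.

Lemma diffeo_stretch n u (i : 'I_n) : C1real u -> (forall t, 0 <= derive1 u t) ->
  diffeo (push u i (delta_mx ord0 i)).
Proof.
move=> Cu u0; have [v [Cv uK vK]] := C1real_inverse Cu u0; split.
  have K (a b : R -> R) : cancel (fun t => t + a t) (fun t => t + b t) ->
      cancel (push a i (delta_mx ord0 i)) (push b i (delta_mx ord0 i)).
    move=> ab x; rewrite /push !mxE !eqxx mulr1 -addrA -scalerDl.
    by have := ab (x ord0 i) => E; rewrite (_ : _ + b _ = 0) ?scale0r ?addr0//; lra.
  exists (push v i (delta_mx ord0 i)); split; [exact: K|exact: K| |].
  - by case: (push_C1 i (delta_mx ord0 i) Cu).
  - by case: (push_C1 i (delta_mx ord0 i) Cv).
move=> x; rewrite (proj2 (push_C1 i _ Cu)) det_push mxE !eqxx mulr1.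
by rewrite ltr_pwDl.
Qed.

End Splines.

(** * Spreading the boxes of a pattern along the diagonal *)

(** [alpha] is the case lambda = 3. *)
Definition box_map {R : realType} (lambda : R) n (L : dyadic_box n) (x : 'rV[R]_n) : 'rV[R]_n :=
  \row_i phi_word lambda (L i) (x ord0 i).

Section Spread.
Context {R : realType} {n : nat} (lambda : R) (hl : 2 < lambda) (hn : (1 < n)%N).
Implicit Types (x y w : 'rV[R]_n) (L : dyadic_box n) (P Q : seq (dyadic_box n)).

Lemma unit_cubeP y : unit_cube y <-> forall i, 0 <= y ord0 i <= 1.
Proof. by split=> h i; have := h i; rewrite /= in_itv. Qed.

Lemma pushE u (i : 'I_n) w x m : (push u i w x) ord0 m = x ord0 m + u (x ord0 i) * w ord0 m.
Proof. by rewrite !mxE. Qed.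

(** Cubes at different slots are told apart by every coordinate, whose values
    stay within distance 1 of different multiples of 10. *)
Definition slot (k : nat) : 'rV[R]_n := const_mx (10 * k%:R).

Lemma slotE y k m : (y + slot k) ord0 m = y ord0 m + 10 * k%:R.
Proof. by rewrite !mxE. Qed.

Lemma slot_near (y : 'rV[R]_n) k m : unit_cube y -> `|(y + slot k) ord0 m - 10 * k%:R| <= 2.
Proof.
move=> /unit_cubeP/(_ m)/andP[y0 y1]; rewrite slotE addrK ger0_norm//; lra.
Qed.

Lemma other_dir (i : 'I_n) : exists j : 'I_n, j != i.
Proof.
have [->|i0] := eqVneq i (Ordinal (ltnW hn)); first by exists (Ordinal hn).
by exists (Ordinal (ltnW hn)); rewrite eq_sym.
Qed.

(** The i-th coordinate identifies the cube, so a shear can move all the other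
    coordinates to their new places; another coordinate then identifies the
    cube and corrects the i-th one. *)
Lemma permute_slots N (s s' : nat -> nat) :
  (forall k, (k < N)%N -> (s k < N)%N /\ s' (s k) = k) ->
  exists2 F, diffeo F &
    forall k y, (k < N)%N -> unit_cube y -> F (y + slot k) = y + slot (s k).
Proof.
move=> hs; pose i := Ordinal (ltnW hn); have [j ji] := other_dir i.
have [u Cu hu] := @interpolation R N (fun=> 0) (fun k => 10 * ((s k)%:R - k%:R)).
have [v Cv hv] := @interpolation R N (fun=> 0) (fun k => 10 * (k%:R - (s' k)%:R)).
pose w : 'rV[R]_n := const_mx 1 - delta_mx ord0 i.
have wE m : w ord0 m = (m != i)%:R.
  by rewrite !mxE eqxx /=; case: (m == i); rewrite /= ?subrr ?subr0.
exists (push v j (delta_mx ord0 i) \o push u i w).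
  apply: diffeo_comp; apply: diffeo_shear => //.
  by rewrite mxE (negbTE ji) andbF.
move=> k y kN cy; have [skN ssk] := hs _ kN; apply/rowP => m /=.
have E : (push u i w (y + slot k)) ord0 j = (y + slot (s k)) ord0 j.
  rewrite pushE (hu k)//; last exact: slot_near.
  by rewrite wE ji !slotE /=; ring.
rewrite pushE E (hv (s k))//; last exact: slot_near.
rewrite pushE (hu k)//; last exact: slot_near.
by rewrite wE ssk !slotE !mxE eqxx /=; case: (m == i) => /=; ring.
Qed.

Definition spread P : Prop := exists2 F, diffeo F &
  forall k y, (k < size P)%N -> unit_cube y ->
    F (box_map lambda (nth [ffun=> [::]] P k) y) = y + slot k.

Definition half_map (i : 'I_n) b y : 'rV[R]_n :=
  \row_m if m == i then phi lambda b (y ord0 m) else y ord0 m.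

Lemma box_map_half L i b y : box_map lambda (half_box L i b) y = box_map lambda L (half_map i b y).
Proof.
by apply/rowP => m; rewrite !mxE ffunE; case: eqP => // _; rewrite phi_word_rcons.
Qed.

Lemma half_map_cube i b y : unit_cube y -> unit_cube (half_map i b y).
Proof.
by move=> /unit_cubeP h; apply/unit_cubeP => m; rewrite mxE; case: eqP => // _; exact: phi01.
Qed.

(** The two halves of the k-th cube are first shifted apart in the directions
    other than i, then stretched in direction i, and finally recentred in
    direction i according to another coordinate, which now tells them apart. *)
Lemma split_slot N k (i : 'I_n) : (k < N)%N -> exists2 G, diffeo G &
  [/\ forall l y, (l < k)%N -> unit_cube y -> G (y + slot l) = y + slot l,
      forall b y, unit_cube y -> G (half_map i b y + slot k) = y + slot (k + b) &
      forall l y, (k < l < N)%N -> unit_cube y -> G (y + slot l) = y + slot l.+1].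
Proof.
move=> kN; have [j ji] := other_dir i; have l0 := lamV_gt0 hl; have l2 := lamV_lt hl.
have h2 := hl.
have [st [Cst st0 st1]] := @step R (10 * k%:R + lambda^-1) (10 * k%:R + 1 - lambda^-1) ltac:(lra).
have [ra [Cra ra' ra0 ra1 ra2]] := @ramp R (10 * k%:R - 1) (10 * k%:R + 1) ltac:(lra).
have [A1 _] := C1real_affine (10 : R) 0; have [Cst10 _] := C1real_comp A1 Cst.
have [A2 E2] := C1real_affine (lambda - 1) 0; have [Cstr E3] := C1real_comp A2 Cra.
(* The correction of the i-th coordinate, for the cube l of the new numbering,
   that undoes the displacement caused by the stretch. *)
pose q (l : nat) : R := if (l < k)%N then 0 else if l == k then - ((lambda - 1) / 2) else
  if l == k.+1 then 10 - 3 / 2 * (lambda - 1) else 10 - 2 * (lambda - 1).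
have [v Cv hv] := @interpolation R N.+1 (fun=> 0) q.
pose w : 'rV[R]_n := const_mx 1 - delta_mx ord0 i.
have wE m : w ord0 m = (m != i)%:R.
  by rewrite !mxE eqxx /=; case: (m == i); rewrite /= ?subrr ?subr0.
have dE m : (delta_mx ord0 i : 'rV[R]_n) ord0 m = (m == i)%:R by rewrite mxE eqxx.
pose G1 := push (fun t => 10 * st t + 0) i w.
pose G2 := push (fun t => (lambda - 1) * ra t + 0) i (delta_mx ord0 i).
pose G3 := push v j (delta_mx ord0 i).
exists (G3 \o (G2 \o G1)).
  apply: diffeo_comp; last apply: diffeo_comp.
  - by apply: diffeo_shear => //; rewrite mxE (negbTE ji) andbF.
  - by apply: diffeo_stretch => // t; rewrite E3 E2 mulr_ge0//; lra.
  - by apply: diffeo_shear => //; rewrite ?wE ?eqxx.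
(* The image under the composite, coordinatewise, of a point whose i-th
   coordinate lies in a range where the step and the ramp are affine. *)
have key (z y : 'rV[R]_n) l (d e : R) : (l < N.+1)%N -> unit_cube y ->
    (forall m, m != i -> z ord0 m + d = (y + slot l) ord0 m) ->
    10 * st (z ord0 i) = d -> (lambda - 1) * ra (z ord0 i) = e ->
    z ord0 i + e + q l = (y + slot l) ord0 i ->
    (G3 \o (G2 \o G1)) z = y + slot l.
  move=> lN cy zm zd ze zi; apply/rowP => m /=.
  have H1 p : (G1 z) ord0 p = if p == i then z ord0 i else z ord0 p + d.
    by rewrite pushE wE addr0 zd; have [->|_] := eqVneq p i; rewrite /= ?mulr0 ?addr0 ?mulr1.
  have H2 p : (G2 (G1 z)) ord0 p = if p == i then z ord0 i + e else z ord0 p + d.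
    rewrite pushE !H1 eqxx addr0 ze dE.
    by have [_|_] := eqVneq p i; rewrite /= ?mulr0 ?addr0 ?mulr1.
  rewrite pushE !H2 (negbTE ji) (zm j ji) (hv l)//; last exact: slot_near.
  rewrite dE mul0r add0r; have [->|mi] := eqVneq m i.
    by rewrite mulr1.
  by rewrite mulr0 addr0 zm.
have nat_lt a b : (a < b)%N -> (a%:R + 1 <= b%:R :> R) by rewrite natr1 ler_nat.
split.
- move=> l y lk cy; have /unit_cubeP/(_ i)/andP[y0 y1] := cy.
  have lk' := nat_lt _ _ lk.
  apply: (key _ _ _ 0 0) => //; first by lia.
  + by move=> m _; rewrite addr0.
  + by rewrite st0 ?mulr0// slotE; lra.
  + by rewrite ra0 ?mulr0// slotE; lra.
  + by rewrite /q lk !addr0.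
- move=> b y cy; have /unit_cubeP/(_ i)/andP[y0 y1] := cy.
  have zi : (half_map i b y + slot k) ord0 i = phi lambda b (y ord0 i) + 10 * k%:R.
    by rewrite slotE mxE eqxx.
  have zm m : m != i -> (half_map i b y + slot k) ord0 m = y ord0 m + 10 * k%:R.
    by move=> mi; rewrite slotE mxE (negbTE mi).
  have ll : lambda * lambda^-1 = 1 by rewrite mulfV// (lam_neq0 hl).
  have ll' : lambda * (lambda^-1 * y ord0 i) = y ord0 i by rewrite mulrA ll mul1r.
  case: b zi zm => zi zm; move: zi; rewrite (phiE hl) /= ?mulr1n ?mulr0n => zi.
  + apply: (key _ _ _ 10 ((lambda - 1) * (lambda^-1 * y ord0 i + (1 - lambda^-1) + 2^-1))) => //.
      by lia.
    * by move=> m mi; rewrite zm// slotE natrD; lra.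
    * by rewrite zi st1 ?mulr1//; nra.
    * by rewrite zi ra1; [congr (_ * _); lra|apply/andP; split; nra].
    * rewrite zi slotE natrD addn1 /q (_ : (k.+1 < k)%N = false); last by lia.
      rewrite (_ : (k.+1 == k) = false); last by lia.
      by rewrite eqxx; nra.
  + apply: (key _ _ _ 0 ((lambda - 1) * (lambda^-1 * y ord0 i + 2^-1))) => //; first by lia.
    * by move=> m mi; rewrite zm// slotE addn0; lra.
    * by rewrite zi st0 ?mulr0//; nra.
    * by rewrite zi ra1; [congr (_ * _); lra|apply/andP; split; nra].
    * rewrite zi slotE /q addn0 ltnn eqxx; nra.
- move=> l y /andP[kl lN] cy; have /unit_cubeP/(_ i)/andP[y0 y1] := cy.
  have kl' := nat_lt _ _ kl.
  apply: (key _ _ _ 10 ((lambda - 1) * 2)) => //.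
  + by move=> m _; rewrite !slotE -natr1; lra.
  + by rewrite st1 ?mulr1// slotE; lra.
  + by rewrite ra2 ?slotE; [congr (_ * _); lra|lra].
  + rewrite !slotE /q (_ : (l.+1 < k)%N = false); last by lia.
    rewrite (_ : (l.+1 == k) = false); last by lia.
    rewrite (_ : (l.+1 == k.+1) = false); last by lia.
    by rewrite -natr1; lra.
Qed.

(** Each step of the construction of the pattern is followed by a diffeomorphism:
    halving splits a cube, renumbering permutes the cubes. *)
Lemma pattern_spread P : pattern P -> spread P.
Proof.
elim=> {P} [|P1 L P2 i _ [F dF hF]|P Q PQ _ [F dF hF]].
- exists idfun; first exact: diffeo_id.
  move=> [|//] y _ _ /=; apply/rowP => i; rewrite !mxE ffunE /= mulr0 addr0//.
- have kN : (size P1 < size (P1 ++ L :: P2))%N by rewrite size_cat /= addnS ltnS leq_addr.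
  have [G dG [G1 G2 G3]] := split_slot i kN.
  exists (G \o F); first exact: diffeo_comp.
  move=> k y; rewrite size_cat /= => hk cy; rewrite nth_cat.
  have hs : size (P1 ++ L :: P2) = (size P1 + (size P2).+1)%N by rewrite size_cat.
  case: ltnP => [kP|Pk].
    have := hF k y; rewrite nth_cat kP hs => ->//; first exact: G1.
    by lia.
  have half b : F (box_map lambda (half_box L i b) y) = half_map i b y + slot (size P1).
    have := hF (size P1) (half_map i b y).
    rewrite nth_cat ltnn subnn /= box_map_half => ->//.
    exact: half_map_cube.
  case Ek : (k - size P1)%N => [|[|l]] /=.
  + by rewrite half G2// addn0; congr (_ + slot _); lia.
  + by rewrite half G2//; congr (_ + slot _); lia.
  + have := hF (size P1 + l.+1)%N y; rewrite nth_cat hs.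
    rewrite (_ : (size P1 + l.+1 < size P1)%N = false); last by lia.
    rewrite addKn /= => ->//; last by lia.
    by rewrite G3//; [congr (_ + slot _); lia|rewrite hs; apply/andP; split; lia].
- have QP : perm_eq Q P by rewrite perm_sym.
  have [Is pI E] := perm_iotaP [ffun=> [::]] QP.
  have sI : size Is = size P by rewrite (perm_size pI) size_iota.
  have sQ : size Q = size P by rewrite (perm_size QP).
  have uI : uniq Is by rewrite (perm_uniq pI) iota_uniq.
  have Ilt k : (k < size P)%N -> (nth 0 Is k < size P)%N.
    move=> kP; have := mem_nth 0 (s := Is); rewrite sI => /(_ _ kP).
    by rewrite (perm_mem pI) mem_iota.
  have memI k : (k < size P)%N -> k \in Is by move=> kP; rewrite (perm_mem pI) mem_iota.
  have hI k : (k < size P)%N -> (index k Is < size P)%N /\ nth 0 Is (index k Is) = k.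
    by move=> kP; rewrite -sI index_mem memI// nth_index// memI.
  have [G dG hG] := permute_slots hI.
  exists (G \o F); first exact: diffeo_comp.
  move=> k y; rewrite sQ => kP cy /=; rewrite E (nth_map 0) ?sI//.
  rewrite hF ?Ilt//.
  by rewrite hG ?Ilt// index_uniq ?sI.
Qed.

End Spread.

(** * Symmetries of the cube *)

Section CubeSymmetry.
Context {R : realType} {n : nat}.
Implicit Types (y : 'rV[R]_n) (s t : 'S_n) (e d : 'I_n -> bool).

Definition flip (b : bool) (a : R) : R := if b then 1 - a else a.

Definition signed_perm s e y : 'rV[R]_n := \row_i flip (e i) (y ord0 (s i)).

(** The sign of the determinant of the linear part, additively. *)
Definition parity s e : bool := s (+) \big[addb/false]_i e i.

Lemma signed_permE s e y i : signed_perm s e y ord0 i = flip (e i) (y ord0 (s i)).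
Proof. by rewrite mxE. Qed.

Lemma flipK b : involutive (flip b).
Proof. by case: b => a //=; rewrite subKr. Qed.

Lemma flip_addb b c a : flip (b (+) c) a = flip b (flip c a).
Proof. by case: b; case: c => //=; rewrite subKr. Qed.

Lemma flip01 b a : 0 <= a <= 1 -> 0 <= flip b a <= 1.
Proof. by case: b => //= /andP[? ?]; apply/andP; split; lra. Qed.

Lemma signed_perm_comp s t e d y : signed_perm s e (signed_perm t d y) =
  signed_perm (s * t)%g (fun i => e i (+) d (s i)) y.
Proof. by apply/rowP => i; rewrite !mxE flip_addb permM. Qed.

Lemma parity_comp s t e d :
  parity (s * t)%g (fun i => e i (+) d (s i)) = parity s e (+) parity t d.
Proof.
have Ed : \big[addb/false]_i d (s i) = \big[addb/false]_i d i by rewrite [RHS](reindex_perm s).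
by rewrite /parity odd_permM big_split /= Ed addbACA.
Qed.

Lemma signed_permVK s e y :
  signed_perm s e (signed_perm s^-1 (fun i => e (s^-1%g i)) y) = y.
Proof. by apply/rowP => i; rewrite !mxE permK flipK. Qed.

Definition signed_perm_mx s e : 'M[R]_n := \matrix_(k, i) ((k == s i)%:R * (-1) ^+ e i).

Lemma signed_permM s e y :
  signed_perm s e y = y *m signed_perm_mx s e + \row_i (e i)%:R.
Proof.
apply/rowP => i; rewrite !mxE (bigD1 (s i))//= big1 ?addr0.
  by rewrite mxE eqxx mul1r; case: (e i); rewrite /flip /= ?expr1 ?expr0; ring.
by move=> k ks; rewrite mxE (negbTE ks) mul0r mulr0.
Qed.

Lemma det_signed_perm_mx s e : \det (signed_perm_mx s e) = (-1) ^+ parity s e.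
Proof.
have -> : signed_perm_mx s e = (diag_mx (\row_i (-1) ^+ e i) *m perm_mx s)^T.
  apply/matrixP => k i; rewrite !mxE (bigD1 i)//= big1 ?addr0.
    by rewrite !mxE eqxx mulr1n eq_sym mulrC.
  by move=> l li; rewrite !mxE eq_sym (negbTE li) mulr0n mul0r.
rewrite det_tr det_mulmx det_perm det_diag /parity signr_addb mulrC; congr (_ * _).
rewrite (big_morph (fun b : bool => (-1 : R) ^+ b) (id1 := 1) (op1 := *%R)) //.
  by apply: eq_bigr => i _; rewrite mxE.
by move=> a b; rewrite signr_addb.
Qed.

Lemma signed_perm_mx_orth s e : signed_perm_mx s e *m (signed_perm_mx s e)^T = 1%:M.
Proof.
apply/matrixP => k l; rewrite !mxE (bigD1 (s^-1%g k))//= big1 ?addr0.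
  rewrite !mxE permKV eqxx mul1r mulrCA -expr2 sqrr_sign mulr1 eq_sym.
  by case: eqP.
move=> i ik; rewrite !mxE; case: eqP => [E|_]; last by rewrite !mul0r.
by move: ik; rewrite E permK eqxx.
Qed.

Lemma unit_cube_signed_perm s e y : unit_cube y -> unit_cube (signed_perm s e y).
Proof. by move=> /unit_cubeP h; apply/unit_cubeP => i; rewrite mxE flip01. Qed.

Lemma cube_symmetry_signed_perm s e : ~~ parity s e -> cube_symmetry (signed_perm s e).
Proof.
move=> ev; exists (signed_perm_mx s e), (\row_i (e i)%:R); split.
- exact: signed_perm_mx_orth.
- by rewrite det_signed_perm_mx (negbTE ev).
- exact: signed_permM.
- apply/seteqP; split=> [_ [y cy <-]|y cy]; first exact: unit_cube_signed_perm.
  exists (signed_perm s^-1 (fun i => e (s^-1%g i)) y); last exact: signed_permVK.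
  exact: unit_cube_signed_perm.
Qed.

(** An orthogonal matrix has columns of Euclidean norm 1; if it maps the cube
    into the cube up to translation its columns have 1-norm at most 1.  Such a
    column has exactly one nonzero entry, which is 1 or -1. *)
Lemma cube_symmetryP S : @cube_symmetry R n S ->
  exists s e, ~~ parity s e /\ S = signed_perm s e.
Proof.
move=> [M [v [MM dM SE Scube]]].
have MTM : M^T *m M = 1%:M by exact: mulmx1C.
have colM i i' : \sum_k M k i * M k i' = (i == i')%:R.
  have := congr1 (fun A : 'M[R]_n => A i i') MTM; rewrite !mxE => <-.
  by apply: eq_bigr => k _; rewrite mxE.
have S01 y i : unit_cube y -> 0 <= \sum_k y ord0 k * M k i + v ord0 i <= 1.
  move=> cy; have : unit_cube (S y) by rewrite -Scube; exists y.
  by move=> /unit_cubeP/(_ i); rewrite SE !mxE.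
have b01 (b : bool) : 0 <= (b%:R : R) <= 1 by case: b; rewrite /= ?lexx ler01.
have l1 i : \sum_k `|M k i| <= 1.
  pose yp : 'rV[R]_n := \row_k (0 <= M k i)%R%:R.
  pose ym : 'rV[R]_n := \row_k (M k i < 0)%R%:R.
  have cp : unit_cube yp by apply/unit_cubeP => k; rewrite mxE b01.
  have cm : unit_cube ym by apply/unit_cubeP => k; rewrite mxE b01.
  have /andP[_ h1] := S01 yp i cp; have /andP[h2 _] := S01 ym i cm.
  rewrite (_ : \sum_k `|M k i| = \sum_k yp ord0 k * M k i - \sum_k ym ord0 k * M k i); first lra.
  rewrite -sumrB; apply: eq_bigr => k _; rewrite !mxE.
  have [M0|M0] := leP 0 (M k i).
    by rewrite ger0_norm//= mul1r mul0r subr0.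
  by rewrite ltr0_norm//= mul1r mul0r sub0r.
have l1' k i : `|M k i| <= 1.
  apply: le_trans (l1 i); rewrite (bigD1 k)//= lerDl; exact: sumr_ge0.
have sq k i : `|M k i| = M k i ^+ 2.
  have h0 l : 0 <= `|M l i| - M l i ^+ 2.
    rewrite subr_ge0 -[leLHS](ger0_norm (sqr_ge0 _)) normrX expr2.
    by rewrite ler_piMl.
  have hs : \sum_l (`|M l i| - M l i ^+ 2) <= 0.
    rewrite sumrB subr_le0; have := colM i i; rewrite eqxx /= => E.
    have -> : \sum_l M l i ^+ 2 = 1 by rewrite -[RHS]E; apply: eq_bigr.
    exact: l1.
  apply/eqP; rewrite -subr_eq0 eq_le h0 andbT.
  apply: le_trans hs; rewrite (bigD1 k)//= lerDl; exact: sumr_ge0.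
have val01 k i : M k i != 0 -> `|M k i| = 1.
  move=> nz; apply: (mulfI (x := `|M k i|)); first by rewrite normr_eq0.
  by rewrite mulr1 [RHS]sq -normrM ger0_norm ?expr2// -expr2 sqr_ge0.
have ex i : exists k, M k i != 0.
  apply: contrapT => h; have := colM i i; rewrite eqxx big1 => [|k _].
    by move/eqP; rewrite eq_sym oner_eq0.
  have [->|nz] := eqVneq (M k i) 0; first by rewrite mul0r.
  by case: h; exists k.
have [f hf] := choice ex.
have f0 k i : k != f i -> M k i = 0.
  move=> kf; apply/eqP; rewrite -normr_le0.
  have := l1 i; rewrite (bigD1 (f i))//= val01// (bigD1 k)//= => h.
  have h3 : 0 <= \sum_(l < n | (l != f i) && (l != k)) `|M l i| by exact: sumr_ge0.
  lra.
have finj : injective f.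
  move=> i i' E; apply/eqP; have := colM i i'; rewrite (bigD1 (f i))//= big1 ?addr0.
    case: eqP => // _ /eqP; rewrite mulf_eq0 (negbTE (hf i)) /=.
    by rewrite E (negbTE (hf i')).
  by move=> k kf; rewrite f0// mul0r.
pose s := perm finj; pose e i : bool := M (f i) i < 0.
have ME : M = signed_perm_mx s e.
  apply/matrixP => k i; rewrite !mxE permE; have [->|kf] := eqVneq k (f i); last first.
    by rewrite f0// mul0r.
  have hv := val01 _ _ (hf i); rewrite mul1r /e; case: ltgtP => m0 /=.
  - by move: hv; rewrite ltr0_norm// expr1 => <-; rewrite opprK.
  - by move: hv; rewrite gtr0_norm.
  - by have := hf i; rewrite m0 eqxx.
have vE : v = \row_i (e i)%:R.
  apply/rowP => i; rewrite mxE.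
  have c0 : unit_cube (0 : 'rV[R]_n) by apply/unit_cubeP => k; rewrite mxE lexx ler01.
  have c1 : unit_cube (const_mx 1 : 'rV[R]_n) by apply/unit_cubeP => k; rewrite mxE lexx ler01.
  have := S01 _ i c1; have := S01 _ i c0.
  rewrite big1 ?add0r; last by move=> k _; rewrite mxE mul0r.
  rewrite (bigD1 (f i))//= big1 ?addr0 ?mxE ?mul1r; last by move=> k kf; rewrite f0// mulr0.
  have -> : M (f i) i = (-1) ^+ e i by rewrite ME mxE permE eqxx mul1r.
  by case: (e i); rewrite /= ?expr1 ?expr0 => /andP[? ?] /andP[? ?]; lra.
exists s, e; split.
  apply/negP => p1; have := det_signed_perm_mx s e.
  rewrite -ME dM p1 expr1 => /eqP; rewrite -subr_eq0 opprK -mulr2n.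
  by rewrite pnatr_eq0.
by apply/funext => y; rewrite SE signed_permM -ME -vE.
Qed.

End CubeSymmetry.

(** * Realizing symmetries of one cube and all pattern maps *)

Section Realize.
Context {R : realType} {n : nat} (lambda : R) (hl : 2 < lambda) (hn : (1 < n)%N).
Implicit Types (y : 'rV[R]_n) (s t : 'S_n) (e d : 'I_n -> bool).

(** The number N of cubes is universally quantified because the diffeomorphism
    has to fix all the other cubes that are present. *)
Definition realizable (S : 'rV[R]_n -> 'rV[R]_n) : Prop :=
  forall N k, (k < N)%N -> exists2 G, diffeo G &
    (forall y, unit_cube y -> G (y + slot k) = S y + slot k) /\
    (forall l y, (l < N)%N -> l != k -> unit_cube y -> G (y + slot l) = y + slot l).

Lemma realizable_comp s e t d :
  realizable (signed_perm s e) -> realizable (signed_perm t d) ->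
  realizable (signed_perm (s * t)%g (fun i => e i (+) d (s i))).
Proof.
move=> h1 h2 N k kN; have [G1 dG1 [G1k G1l]] := h1 N k kN.
have [G2 dG2 [G2k G2l]] := h2 N k kN.
exists (G1 \o G2); first exact: diffeo_comp.
split=> [y cy|l y lN lk cy] /=.
  by rewrite G2k// G1k ?signed_perm_comp//; exact: unit_cube_signed_perm.
by rewrite G2l// G1l.
Qed.

(** In coordinates centred at the cube, (X, Y) is sent to (X - Y, Y), then to
    (X - Y, X), then to (- Y, X).  The shears are cut off outside the slot k,
    which the intermediate images do not leave by more than the margin of
    [interpolation]. *)
Lemma realizable_quarter_turn (i j : 'I_n) : i != j ->
  realizable (signed_perm (tperm i j) (pred1 i)).
Proof.
move=> ij N k kN.
have [u Cu hu] := @interpolation R N (fun l => (l == k)%:R)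
  (fun l => (l == k)%:R * - (10 * k%:R + 2^-1)).
have uk (t : R) : `|t - 10 * k%:R| <= 2 -> u t = t - (10 * k%:R + 2^-1).
  by move=> h; rewrite (hu k)// eqxx !mul1r.
have ul l (t : R) : (l < N)%N -> l != k -> `|t - 10 * l%:R| <= 2 -> u t = 0.
  by move=> lN /negbTE lk h; rewrite (hu l)// lk !mul0r addr0.
pose T1 := push u j (- delta_mx ord0 i : 'rV[R]_n).
pose T2 := push u i (delta_mx ord0 j : 'rV[R]_n).
have dE (p m : 'I_n) : (delta_mx ord0 p : 'rV[R]_n) ord0 m = (m == p)%:R.
  by rewrite mxE eqxx.
have dNE (p m : 'I_n) : (- delta_mx ord0 p : 'rV[R]_n) ord0 m = - (m == p)%:R.
  by rewrite mxE dE.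
have dT1 : diffeo T1.
  by apply: diffeo_shear => //; rewrite dNE eq_sym (negbTE ij) oppr0.
have dT2 : diffeo T2 by apply: diffeo_shear => //; rewrite dE (negbTE ij).
exists (T1 \o (T2 \o T1)); first exact: (diffeo_comp dT1 (diffeo_comp dT2 dT1)).
split=> [y cy|l y lN lk cy] /=; last first.
  have E1 : T1 (y + slot l) = y + slot l.
    by apply/rowP => m; rewrite pushE (ul l) ?mul0r ?addr0//; exact: slot_near.
  have E2 : T2 (y + slot l) = y + slot l.
    by apply/rowP => m; rewrite pushE (ul l) ?mul0r ?addr0//; exact: slot_near.
  by rewrite E1 E2 E1.
have ji : j != i by rewrite eq_sym.
have /unit_cubeP cy' := cy; have /andP[i0 i1] := cy' i; have /andP[j0 j1] := cy' j.
have H1 m : (T1 (y + slot k)) ord0 m =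
    (if m == i then y ord0 i - y ord0 j + 2^-1 else y ord0 m) + 10 * k%:R.
  rewrite pushE uk; last exact: slot_near.
  by rewrite dNE !slotE; have [->|_] := eqVneq m i; rewrite /=; ring.
have H2 m : (T2 (T1 (y + slot k))) ord0 m =
    (if m == i then y ord0 i - y ord0 j + 2^-1 else if m == j then y ord0 i else y ord0 m)
     + 10 * k%:R.
  rewrite pushE uk; last by rewrite H1 eqxx addrK ler_norml; apply/andP; split; lra.
  rewrite dE !H1 eqxx; have [->|mi] := eqVneq m i; first by rewrite (negbTE ij) mulr0 addr0.
  by have [->|_] := eqVneq m j; rewrite /=; ring.
apply/rowP => m; rewrite pushE uk; last first.
  by rewrite H2 (negbTE ji) eqxx addrK ger0_norm//; lra.
rewrite dNE !H2 (negbTE ji) eqxx slotE mxE /=.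
have [->|mi] := eqVneq m i; first by rewrite tpermL /flip /=; lra.
have [->|mj] := eqVneq m j; first by rewrite tpermR /flip /=; lra.
by rewrite tpermD 1?eq_sym// /flip /= oppr0 mulr0 addr0.
Qed.

Lemma realizable_id : realizable (signed_perm 1%g (fun=> false)).
Proof.
move=> N k kN; exists idfun; first exact: diffeo_id.
split=> // y _ /=; congr (_ + _).
by apply/rowP => i; rewrite mxE perm1.
Qed.

Lemma eq_realizable s e e' : e =1 e' -> realizable (signed_perm s e) -> realizable (signed_perm s e').
Proof. by move=> /funext ->. Qed.

(** Two sign changes are the square of a quarter turn, and an even number of
    them can be treated two at a time. *)
Lemma realizable_signs e : ~~ parity (1%g : 'S_n) e -> realizable (signed_perm 1%g e).
Proof.
rewrite /parity odd_perm1 /=.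
have [c] := ubnP #|[pred i | e i]|; elim: c e => // c IH e hc ev.
have [i ei|e0] := pickP e; last first.
  by apply: eq_realizable realizable_id => i; rewrite e0.
have [j /andP[ej ji]|h] := pickP [pred j | e j && (j != i)]; last first.
  move: ev; rewrite (bigD1 i)//= ei big1 // => j ji.
  by have := h j; rewrite /= ji andbT.
pose d m := [&& e m, m != i & m != j].
have dE m : d m = e m (+) ((m == i) || (m == j)).
  rewrite /d; have [->|_] := eqVneq m i; first by rewrite ei andbF.
  by have [->|_] := eqVneq m j; rewrite ?ej ?andbF ?andbT ?addbF.
have ij : i != j by rewrite eq_sym.
have half : realizable (signed_perm 1%g (fun m => (m == i) || (m == j))).
  have := realizable_comp (realizable_quarter_turn ij) (realizable_quarter_turn ij).
  rewrite tperm2; apply: eq_realizable => m /=.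
  have [->|mi] := eqVneq m i; first by rewrite tpermL (negbTE ji).
  have [->|mj] := eqVneq m j; first by rewrite tpermR eqxx.
  by rewrite tpermD; [rewrite (negbTE mi)|rewrite eq_sym|rewrite eq_sym].
have hd : realizable (signed_perm 1%g d).
  apply: IH.
    apply: leq_trans (_ : #|[pred m | e m]| <= c)%N => //.
    apply: proper_card; apply/properP; split.
      by apply/fintype.subsetP => m; rewrite !inE => /and3P[].
    by exists i; rewrite !inE // /d eqxx andbF.
  have E2 : \big[addb/false]_m ((m == i) || (m == j)) = false.
    rewrite (bigD1 i)//= eqxx (bigD1 j)//= eqxx orbT big1 // => m.
    by move=> /andP[/negbTE -> /negbTE ->].
  by rewrite (eq_bigr _ (fun m _ => dE m)) big_split /= E2 addbF.
have := realizable_comp hd half; rewrite mulg1; apply: eq_realizable => m /=.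
by rewrite perm1 dE -addbA addbb addbF.
Qed.

(** A quarter turn is a transposition together with one sign change, so a
    decomposition of s into transpositions reduces to the case s = 1. *)
Lemma realizable_signed_perm s e : ~~ parity s e -> realizable (signed_perm s e).
Proof.
have [ts -> dts] := prod_tpermP s.
elim: ts dts e => [_|[a b] ts IH /andP[/= ab dts]] e; rewrite ?big_nil ?big_cons /=.
  exact: realizable_signs.
set s' := bigop _ _ _ => ev.
pose d m := e (tperm a b m) (+) (tperm a b m == a).
have E m : (m == a) (+) d (tperm a b m) = e m.
  by rewrite /d tpermK; case: (m == a); rewrite /= ?addbT ?negbK ?addbF.
have hd : ~~ parity s' d.
  have := parity_comp (tperm a b) s' (pred1 a) d.
  have -> : (fun i => pred1 a i (+) d (tperm a b i)) = e by apply/funext => m; exact: E.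
  have -> : parity (tperm a b) (pred1 a) = false.
    rewrite /parity odd_tperm ab (bigD1 a)//= eqxx big1 // => m /negbTE /=.
    by [].
  by rewrite addFb => <-.
have := realizable_comp (realizable_quarter_turn ab) (IH dts d hd).
by apply: eq_realizable => m; exact: E.
Qed.

Lemma realize_all N (S : nat -> 'rV[R]_n -> 'rV[R]_n) :
  (forall k, cube_symmetry (S k)) -> exists2 G, diffeo G &
    forall l y, (l < N)%N -> unit_cube y -> G (y + slot l) = S l y + slot l.
Proof.
move=> hS.
have rS k : realizable (S k) /\ forall y, unit_cube y -> unit_cube (S k y).
  have [s [e [ev ->]]] := cube_symmetryP (hS k); split.
    exact: realizable_signed_perm.
  by move=> y; exact: unit_cube_signed_perm.
suff h m : (m <= N)%N -> exists2 G, diffeo G & forall l y, (l < N)%N -> unit_cube y ->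
    G (y + slot l) = (if (l < m)%N then S l y else y) + slot l.
  by have [G dG hG] := h N (leqnn N); exists G => // l y lN cy; rewrite hG// lN.
elim: m => [_|m IH mN].
  by exists idfun; first exact: diffeo_id.
have [G dG hG] := IH (ltnW mN).
have [rm _] := rS m; have [H dH [Hm Hl]] := rm N m mN.
exists (H \o G); first exact: diffeo_comp.
move=> l y lN cy /=; rewrite hG//; have [lm|ml|->] := ltngtP l m.
- rewrite (_ : (l < m.+1)%N = true); last by lia.
  by apply: Hl => //; [rewrite ltn_eqF|have [_] := rS l; exact].
- rewrite (_ : (l < m.+1)%N = false); last by lia.
  by apply: Hl => //; rewrite gtn_eqF.
- by rewrite ltnSn Hm.
Qed.

(** Spread the source pattern, turn each cube, and gather the target pattern. *)
Lemma pattern_realize N (P Q : N.-tuple (dyadic_box n)) (S : 'I_N -> 'rV[R]_n -> 'rV[R]_n) :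
  pattern P -> pattern Q -> (forall i, cube_symmetry (S i)) ->
  exists2 F, diffeo F & forall i y, unit_cube y ->
    F (box_map lambda (tnth P i) y) = box_map lambda (tnth Q i) (S i y).
Proof.
move=> pP pQ hS.
have [FP dFP hFP] := pattern_spread hl hn pP; have [FQ dFQ hFQ] := pattern_spread hl hn pQ.
have [FQ' [dFQ' FQK _]] := diffeo_inv dFQ.
pose S' (k : nat) := if insub k is Some i then S i else idfun.
have hS' k : cube_symmetry (S' k).
  rewrite /S'; case: insubP => [i _ _|_]; first exact: hS.
  have := @cube_symmetry_signed_perm R n 1%g (fun=> false).
  rewrite (_ : signed_perm _ _ = idfun); last first.
    by apply/funext => y; apply/rowP => i; rewrite mxE perm1.
  by apply; rewrite /parity odd_perm1 big1.
have [G dG hG] := realize_all N hS'.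
exists (FQ' \o (G \o FP)); first exact: (diffeo_comp dFQ' (diffeo_comp dG dFP)).
move=> i y cy /=.
have cS : unit_cube (S i y).
  have [s [e [_ ->]]] := cube_symmetryP (hS i); exact: unit_cube_signed_perm.
rewrite (tnth_nth [ffun=> [::]]) hFP ?size_tuple// hG//.
have -> : S' i = S i by rewrite /S' valK.
by rewrite -hFQ ?size_tuple// FQK -tnth_nth.
Qed.

End Realize.

(** * Rigidity: the Jacobian is monomial on the Cantor set *)

Section CantorLocal.
Context {R : realType} (lambda : R) (hl : 2 < lambda).
Implicit Types (x y z : R) (w : seq bool).
Local Notation C := (cantor lambda).

Lemma lamVX_small (r : R) : 0 < r -> exists m, forall k, (m <= k)%N -> lambda^-1 ^+ k < r.
Proof.
move=> r0; have l0 := lamV_gt0 hl; have l2 := lamV_lt hl.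
have /cvgrPdist_lt/(_ _ r0) : (fun m => lambda^-1 ^+ m) @ \oo --> (0 : R).
  by apply: cvg_expr; rewrite gtr0_norm//; lra.
move=> [m _ h]; exists m => k mk; have := h k mk.
by rewrite /= sub0r normrN gtr0_norm ?exprn_gt0.
Qed.

Lemma word_prefix m x : C x -> exists w y, [/\ size w = m, C y & x = phi_word lambda w y].
Proof.
move=> Cx; have [y Cy E] := cantor_prefix hl m Cx.
by exists (mkseq (code lambda x) m), y; rewrite size_mkseq.
Qed.

Lemma phi_word_le w x y : x <= y -> phi_word lambda w x <= phi_word lambda w y.
Proof.
by move=> xy; rewrite -subr_ge0 (phi_wordB hl) mulr_ge0 ?subr_ge0// ltW// (lamVX_gt0 hl).
Qed.

Lemma near_same_word w w' x y : size w = size w' -> 0 <= x <= 1 -> 0 <= y <= 1 ->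
  `|phi_word lambda w x - phi_word lambda w' y| < (lambda - 2) * lambda^-1 ^+ size w -> w = w'.
Proof.
move=> sz hx hy h; apply: contrapT => ne.
by have := phi_word_sep hl sz ne hx hy; rewrite leNgt h.
Qed.

(** The other standard intervals of the same generation are at a positive
    distance. *)
Lemma corner_one_sided w : exists2 r, 0 < r &
  forall z, C z -> `|z - phi_word lambda w 0| < r -> phi_word lambda w 0 <= z.
Proof.
have h2 := hl; exists ((lambda - 2) * lambda^-1 ^+ size w).
  by rewrite mulr_gt0 ?(lamVX_gt0 hl)//; lra.
move=> z Cz; have [w' [y [sw' Cy ->]]] := word_prefix (size w) Cz => h.
have -> : w' = w.
  apply: (near_same_word (x := y) (y := 0)) => //; first exact: (cantor_I hl).
    by rewrite lexx ler01.
  by rewrite sw'.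
by apply: phi_word_le; exact: (cantor_ge0 hl Cy).
Qed.

Lemma cantor_lamVX m : C (lambda^-1 ^+ m).
Proof.
elim: m => [|m IH]; first by rewrite expr0; exact: (cantor1 hl).
by have := cantor_phi hl false IH; rewrite (phiE hl) addr0 exprS.
Qed.

Lemma corner_clusters w r : 0 < r ->
  exists t, 0 < t < r /\ C (phi_word lambda w 0 + 1 * t).
Proof.
move=> r0; have [m hm] := lamVX_small r0.
exists (lambda^-1 ^+ (size w + m)); rewrite (lamVX_gt0 hl) /= hm ?leq_addl//; split=> //.
rewrite mul1r exprD addrC -(phi_wordE hl).
by apply: (cantor_word hl); exact: cantor_lamVX.
Qed.

Lemma cantor_clusters q r : C q -> 0 < r -> exists z, [/\ C z, z != q & `|z - q| < r].
Proof.
move=> Cq r0; have [m hm] := lamVX_small r0.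
have [w [y [sw Cy ->]]] := word_prefix m Cq.
have main y' : C y' -> y' != y -> exists z, [/\ C z, z != phi_word lambda w y &
    `|z - phi_word lambda w y| < r].
  move=> Cy' ne; exists (phi_word lambda w y'); split; first exact: (cantor_word hl).
    by apply: contra ne => /eqP/(phi_word_inj hl) ->.
  by apply: le_lt_trans (phi_word_dist hl _ _ _) _; rewrite ?(cantor_I hl)// sw hm.
have [y0|y0] := eqVneq y 0; last by apply: (main 0); [exact: (cantor0 hl)|rewrite eq_sym].
by apply: (main 1); [exact: (cantor1 hl)|rewrite y0 oner_eq0].
Qed.

End CantorLocal.

Section Monomial.
Context {R : realType} {n : nat} (lambda : R) (hl : 2 < lambda).
Implicit Types (p q x y : 'rV[R]_n) (f : 'rV[R]_n -> 'rV[R]_n) (s t r : R).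
Local Notation C := (cantor lambda).
Local Notation Cn := (@cantor_power R lambda n).

Definition clusters_at (s a : R) : Prop :=
  forall r, 0 < r -> exists t, 0 < t < r /\ C (a + s * t).

Definition one_sided_at (s a : R) : Prop :=
  exists2 r, 0 < r & forall z, C z -> `|z - a| < r -> 0 <= s * (z - a).

Lemma norm_delta t j : `|t *: delta_mx ord0 j : 'rV[R]_n| <= `|t|.
Proof.
apply: mx_norm_le => // i k; rewrite !mxE; case: (_ && _) => /=.
  by rewrite mulr1.
by rewrite mulr0 normr0.
Qed.

(** A derivative of the wrong sign would move points of C^n that tend to p along
    an axis to the side of the image where C is absent. *)
Lemma tangent_sign f p (s s' : R) j i : C1 f -> (forall x, Cn x -> Cn (f x)) -> Cn p ->
  (s == 1) || (s == -1) -> clusters_at s (p ord0 j) ->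
  one_sided_at s' (f p ord0 i) -> 0 <= s * s' * jacobian f p j i.
Proof.
move=> Cf fC Cp s1 acc [r r0 side]; rewrite leNgt; apply/negP => neg.
have ns : `|s| = 1 by case/orP: s1 => /eqP->; rewrite ?normrN normr1.
have e0 : 0 < - (s * s' * jacobian f p j i) / (1 + `|s'|).
  by rewrite divr_gt0 ?oppr_gt0// ltr_pwDl.
have [r1 r10 h1] := C1_strict p Cf e0.
have cf := C1_continuous Cf.
have /cvgrPdist_lt/(_ _ r0)/nbhs_ballP[r2 /= r20 h2] := cf p.
have [|t [/andP[t0 tr] Ct]] := acc (Num.min r1 r2); first by rewrite lt_min r10.
move: tr; rewrite lt_min => /andP[tr1 tr2].
pose y := p + (s * t) *: delta_mx ord0 j.
have yp : y - p = (s * t) *: delta_mx ord0 j by rewrite /y addrC addKr.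
have nyp : `|y - p| <= t.
  by rewrite yp; apply: le_trans (norm_delta _ _) _; rewrite normrM ns mul1r gtr0_norm.
have Cy : Cn y.
  move=> k; rewrite /y !mxE eqxx /=; have [->|_] := eqVneq k j; first by rewrite mulr1.
  by rewrite mulr0 addr0; exact: Cp.
have fy : `|f y ord0 i - f p ord0 i| < r.
  have := h2 y; rewrite -ball_normE /= distrC => /(_ (le_lt_trans nyp tr2)).
  rewrite distrC => h; apply: le_lt_trans h.
  by have := mx_entry_le (f y - f p) ord0 i; rewrite !mxE.
have := side _ (fC _ Cy i) fy; rewrite leNgt => /negP; apply.
have := h1 y p (le_lt_trans nyp tr1); rewrite subrr normr0 => /(_ r10 i).
have -> : ((y - p) *m jacobian f p) ord0 i = s * t * jacobian f p j i.
  by rewrite yp -scalemxAl -rowE !mxE.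
move: neg e0; move: (jacobian f p j i) => J neg e0.
set d := f y ord0 i - f p ord0 i => h.
have {}h : `|d - s * t * J| <= - (s * s' * J) / (1 + `|s'|) * t.
  by apply: (le_trans h); apply: ler_wpM2l => //; exact: ltW.
have E : s' * d = s' * (d - s * t * J) + t * (s * s' * J) by ring.
have h3 : s' * (d - s * t * J) <= `|s'| * (- (s * s' * J) / (1 + `|s'|) * t).
  by apply: le_trans (ler_norm _) _; rewrite normrM ler_wpM2l.
have h4 : `|s'| * (- (s * s' * J) / (1 + `|s'|) * t) < t * - (s * s' * J).
  have -> : `|s'| * (- (s * s' * J) / (1 + `|s'|) * t) =
      t * - (s * s' * J) * (`|s'| / (1 + `|s'|)) by ring.
  have s'0 : 0 <= `|s'| by [].
  rewrite gtr_pMr; last by rewrite mulr_gt0 ?oppr_gt0.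
  by rewrite ltr_pdivrMr; lra.
have := le_lt_trans h3 h4; rewrite [ltRHS]mulrN => h5.
by rewrite E -ltrBrDr sub0r.
Qed.

Context (Phi Psi : 'rV[R]_n -> 'rV[R]_n).
Hypotheses (CPhi : C1 Phi) (CPsi : C1 Psi) (PhiK : cancel Phi Psi) (PsiK : cancel Psi Phi).
Hypotheses (PhiC : forall x, Cn x -> Cn (Phi x)) (PsiC : forall x, Cn x -> Cn (Psi x)).

Lemma jacobian_PhiPsi p : jacobian Phi p *m jacobian Psi (Phi p) = 1%:M.
Proof. exact: jacobianK. Qed.

Lemma jacobian_PsiPhi p : jacobian Psi (Phi p) *m jacobian Phi p = 1%:M.
Proof. exact: mulmx1C (jacobian_PhiPsi p). Qed.

Lemma mul_eq1E (A B : 'M[R]_n) i j : A *m B = 1%:M -> \sum_k A i k * B k j = (i == j)%:R.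
Proof. by move=> /(congr1 (fun M : 'M[R]_n => M i j)); rewrite !mxE. Qed.

Lemma inverse_row_neq0 (A B : 'M[R]_n) i : A *m B = 1%:M -> ~ (forall j, A i j = 0).
Proof.
move=> AB h; have := congr1 (fun M : 'M[R]_n => M i i) AB.
rewrite !mxE big1 => [|k _]; last by rewrite h mul0r.
by rewrite eqxx => /eqP; rewrite eq_sym oner_eq0.
Qed.

(** At a corner p the tangent cone of the Cantor set spans an orthant.  The
    differential of Psi maps the tangent directions at q = Phi p into it, so
    that the Cantor set clusters at each q_i from one side s_i only, and
    conversely the differential of Phi maps the orthant at p into the orthant
    with signs s.  Up to these signs the Jacobian and its inverse are both
    nonnegative, which forces them to be monomial. *)
Lemma monomial_at_corner (w : 'I_n -> seq bool) i j j' : j != j' ->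
  let p := \row_k phi_word lambda (w k) 0 in
  jacobian Phi p j i * jacobian Phi p j' i = 0.
Proof.
move=> jj' p; set q := Phi p.
have Cp : Cn p by move=> k; rewrite mxE; apply: (cantor_word hl); exact: (cantor0 hl).
have Cq : Cn q by exact: PhiC.
have Psiq : Psi q = p by exact: PhiK.
have sidep k : one_sided_at 1 (p ord0 k).
  have [r r0 h] := corner_one_sided hl (w k); exists r => // z Cz.
  by rewrite mxE mul1r subr_ge0; exact: h.
have accp k : clusters_at 1 (p ord0 k).
  by move=> r r0; rewrite mxE; exact: corner_clusters.
have Ksign s k l : (s == 1) || (s == -1) -> clusters_at s (q ord0 k) ->
    0 <= s * jacobian Psi q k l.
  move=> s1 acc; have := @tangent_sign Psi q s 1 k l CPsi PsiC Cq s1 acc.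
  by rewrite Psiq mulr1; apply; exact: sidep.
have notboth k : clusters_at 1 (q ord0 k) -> ~ clusters_at (-1) (q ord0 k).
  move=> a1 a2; apply: (inverse_row_neq0 (i := k) (jacobian_PsiPhi p)) => l.
  apply/eqP; rewrite eq_le; apply/andP; split.
    by rewrite -oppr_ge0 -mulN1r; apply: Ksign => //; rewrite eqxx orbT.
  by rewrite -[leRHS]mul1r; apply: Ksign => //; rewrite eqxx.
have accor k : clusters_at 1 (q ord0 k) \/ clusters_at (-1) (q ord0 k).
  apply: contrapT => /not_orP[/existsNP[r1 /not_implyP[r10 h1]] /existsNP[r2 /not_implyP[r20 h2]]].
  have [|z [Cz zq zr]] := @cantor_clusters _ _ hl (q ord0 k) (Num.min r1 r2) (Cq k).
    by rewrite lt_min r10.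
  move: zr; rewrite lt_min => /andP[z1 z2].
  have [lt|lt|E] := ltgtP z (q ord0 k); last by rewrite E eqxx in zq.
    apply: h2; exists (q ord0 k - z); rewrite subr_gt0 lt /=; split.
      by move: z2; rewrite distrC gtr0_norm ?subr_gt0.
    by rewrite mulN1r opprB addrC subrK.
  apply: h1; exists (z - q ord0 k); rewrite subr_gt0 lt /=; split.
    by move: z1; rewrite gtr0_norm ?subr_gt0.
  by rewrite mul1r addrC subrK.
have sideE s k : (s == 1) || (s == -1) -> ~ clusters_at (- s) (q ord0 k) ->
    one_sided_at s (q ord0 k).
  move=> s1 /existsNP[r /not_implyP[r0 h]]; exists r => // z Cz zr.
  have ss : s * s = 1 by case/orP: s1 => /eqP->; rewrite ?mulrNN mulr1.
  rewrite leNgt; apply/negP => neg; apply: h; exists (- (s * (z - q ord0 k))).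
  rewrite oppr_gt0 neg /=; split.
    apply: le_lt_trans (ler_norm _) _; rewrite normrN normrM.
    by case/orP: s1 => /eqP->; rewrite ?normrN normr1 mul1r.
  by rewrite mulrNN mulrA ss mul1r addrC subrK.
have [k0|] := eqVneq (jacobian Phi p j i) 0; first by rewrite k0 mul0r.
have [k0|] := eqVneq (jacobian Phi p j' i) 0; first by rewrite k0 mulr0.
move=> nz' nz; exfalso.
(* s = 1 or -1 is the side from which C clusters at the k-th coordinate of q. *)
have side k : exists s, [/\ s * s = 1, forall l, 0 <= s * jacobian Psi q k l &
    forall l, 0 <= s * jacobian Phi p l k].
  have [a1|a2] := accor k.
    exists 1; split; [by rewrite mulr1|by move=> l; apply: Ksign => //; rewrite eqxx|].
    move=> l; have := @tangent_sign Phi p 1 1 l k CPhi PhiC Cp.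
    rewrite eqxx mul1r => /(_ isT (accp l)); apply.
    by apply: sideE; [rewrite eqxx|exact: notboth].
  exists (-1); split; [by rewrite mulrNN mulr1|by move=> l; apply: Ksign => //; rewrite eqxx orbT|].
  move=> l; have := @tangent_sign Phi p 1 (-1) l k CPhi PhiC Cp.
  rewrite eqxx mul1r => /(_ isT (accp l)); apply.
  by apply: sideE; [rewrite eqxx orbT|rewrite opprK => a1; exact: notboth a2].
have offdiag a b : a != b -> jacobian Phi p a i * jacobian Psi q i b = 0.
  move=> ab; have := mul_eq1E a b (jacobian_PhiPsi p).
  rewrite (negbTE ab) => /eqP; rewrite psumr_eq0.
    by move=> /allP/(_ i); rewrite mem_index_enum => /(_ isT)/eqP.
  move=> k _; have [s [ss h1 h2]] := side k.
  have := mulr_ge0 (h2 a) (h1 b).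
  by rewrite mulrACA ss mul1r.
apply: (inverse_row_neq0 (i := i) (jacobian_PsiPhi p)) => k.
have [<-|jk] := eqVneq j k.
  have j'j : j' != j by rewrite eq_sym.
  by have /eqP := offdiag j' j j'j; rewrite mulf_eq0 (negbTE nz') => /eqP.
by have /eqP := offdiag j k jk; rewrite mulf_eq0 (negbTE nz) => /eqP.
Qed.

(** Corners are dense in C^n and the condition is closed. *)
Lemma monomial_on_cantor p i j j' : Cn p -> j != j' ->
  jacobian Phi p j i * jacobian Phi p j' i = 0.
Proof.
move=> Cp jj'; apply/eqP; apply: contrapT => /negP nz.
pose F x := jacobian Phi x j i * jacobian Phi x j' i.
have cF : continuous F.
  have [_ cJ] := CPhi; have h1 := @continuous_entry _ _ _ _ _ j i cJ.
  have h2 := @continuous_entry _ _ _ _ _ j' i cJ.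
  by move=> x; exact: (continuousM (h1 x) (h2 x)).
have F0 : 0 < `|F p| by rewrite normr_gt0.
have /cvgrPdist_lt/(_ _ F0)/nbhs_ballP[r /= r0 hr] := cF p.
have [m hm] := lamVX_small hl r0.
have [w hw] := choice (fun k => word_prefix hl m (Cp k)).
pose c : 'rV[R]_n := \row_k phi_word lambda (w k) 0.
have Fc : F c = 0 by exact: (monomial_at_corner w i jj').
suff pc : ball p r c.
  have h : `|F p - F c| < `|F p| := hr c pc.
  by move: h; rewrite Fc subr0 ltxx.
rewrite -ball_normE; apply: le_lt_trans (hm m (leqnn m)).
apply: mx_norm_le => [|a k]; first by rewrite ltW// (lamVX_gt0 hl).
have [y [sw Cy E]] := hw k; rewrite !ord1 !mxE E -sw.
apply: (phi_word_dist hl); first exact: (cantor_I hl).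
by rewrite lexx ler01.
Qed.

Hypothesis orPhi : orientation_preserving Phi.

Lemma monomial_matrix (J K : 'M[R]_n) : K *m J = 1%:M ->
  (forall i j j', j != j' -> J j i * J j' i = 0) -> 0 < \det J ->
  exists (s : 'S_n) (e : 'I_n -> bool) (c : 'I_n -> R),
  [/\ ~~ parity s e, forall i, 0 < c i &
      forall (x : 'rV[R]_n) i, (x *m J) ord0 i = (-1) ^+ e i * c i * x ord0 (s i)].
Proof.
move=> KJ mono dJ.
have ex i : exists j, J j i != 0.
  apply: contrapT => h; have := mul_eq1E i i KJ.
  rewrite big1 => [|k _]; first by rewrite eqxx => /eqP; rewrite eq_sym oner_eq0.
  by have [->|nz] := eqVneq (J k i) 0; [rewrite mulr0|case: h; exists k].
have [f hf] := choice ex.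
have f0 k i : k != f i -> J k i = 0.
  move=> kf; have /eqP := mono i _ _ kf.
  by rewrite mulf_eq0 (negbTE (hf i)) orbF => /eqP.
have KJE k i : K k (f i) * J (f i) i = (k == i)%:R.
  rewrite -(mul_eq1E k i KJ).
  by rewrite (bigD1 (f i))//= big1 ?addr0// => l lf; rewrite f0// mulr0.
have finj : injective f.
  move=> i i' E; apply/eqP; case: eqP => // /eqP ne.
  have := KJE i i'; rewrite (negbTE ne) => /eqP; rewrite mulf_eq0 (negbTE (hf i')) orbF -E.
  by have := KJE i i; rewrite eqxx => h /eqP h2; move/eqP: h; rewrite h2 mul0r eq_sym oner_eq0.
pose s := perm finj; pose e i : bool := J (f i) i < 0; pose c i := `|J (f i) i|.
have JE i : J (f i) i = (-1) ^+ e i * c i.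
  rewrite /e /c; case: (ltP (J (f i) i) 0) => h; rewrite /= ?expr1 ?expr0.
    by rewrite ltr0_norm// mulN1r opprK.
  by rewrite ger0_norm// mul1r.
have c0 i : 0 < c i by rewrite normr_gt0.
exists s, e, c; split=> // [|x i]; last first.
  rewrite [LHS]mxE (bigD1 (f i))//= big1 ?addr0; first by rewrite JE permE mulrC.
  by move=> k kf; rewrite f0// mulr0.
have JM : J = signed_perm_mx s e *m diag_mx (\row_i c i).
  apply/matrixP => k i; rewrite mul_mx_diag [RHS]mxE [X in _ = X * _]mxE [X in _ = _ * X]mxE permE.
  by have [->|kf] := eqVneq k (f i); rewrite ?mul1r ?JE// f0// !mul0r.
move: dJ; rewrite JM det_mulmx det_signed_perm_mx det_diag.
rewrite pmulr_lgt0; last by apply: prodr_gt0 => i _; rewrite mxE.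
by case: parity => //; rewrite expr1 ltr0N1.
Qed.


Lemma jacobian_on_cantor p : Cn p -> exists (s : 'S_n) (e : 'I_n -> bool) (c : 'I_n -> R),
  [/\ ~~ parity s e, forall i, 0 < c i &
      forall x i, (x *m jacobian Phi p) ord0 i = (-1) ^+ e i * c i * x ord0 (s i)].
Proof.
move=> Cp; apply: (monomial_matrix (jacobian_PsiPhi p) _ (orPhi p)) => i j j'.
exact: (monomial_on_cantor i Cp).
Qed.

End Monomial.

(** * Rigidity: subsets of the Cantor set close to an affine copy of it *)

Section AffineCopy.
Context {R : realType} (lambda : R) (hl : 2 < lambda).
Implicit Types (x y z t s : R) (w T : seq bool).
Local Notation C := (cantor lambda).
Local Notation g0 := (1 - 2 * lambda^-1).

Lemma gap_gt0 : 0 < g0.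
Proof. by have := lamV_lt hl; lra. Qed.

Lemma gap_lt1 : g0 < 1.
Proof. by have := lamV_gt0 hl; lra. Qed.

(** Either P changes across the central gap, of length 1 - 2 / lambda, or it
    separates the end points of one of the halves, where the argument is
    repeated at a smaller scale. *)
Lemma dichotomy_gap m (P : R -> Prop) : P 0 -> ~ P 1 -> exists s t,
  [/\ C s, C t, P s, ~ P t & `|t - s| <= Num.max g0 (lambda^-1 ^+ m)].
Proof.
have l0 := lamV_gt0 hl; have gp := gap_gt0.
elim: m P => [|m IH] P P0 P1.
  exists 0, 1; split=> //; [exact: (cantor0 hl)|exact: (cantor1 hl)|].
  by rewrite subr0 normr1 expr0 le_max lexx orbT.
have shrink b : (exists s t, [/\ C s, C t, P (phi lambda b s), ~ P (phi lambda b t)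
    & `|t - s| <= Num.max g0 (lambda^-1 ^+ m)]) ->
    exists s t, [/\ C s, C t, P s, ~ P t & `|t - s| <= Num.max g0 (lambda^-1 ^+ m.+1)].
  move=> [s [t [Cs Ct Ps Pt st]]]; exists (phi lambda b s), (phi lambda b t).
  split=> //; [exact: (cantor_phi hl)|exact: (cantor_phi hl)|].
  have -> : phi lambda b t - phi lambda b s = lambda^-1 * (t - s).
    by rewrite !(phiE hl); ring.
  rewrite normrM gtr0_norm//; apply: (le_trans (ler_wpM2l (ltW l0) st)).
  rewrite (maxr_pMr _ _ (ltW l0)) exprS ge_max !le_max lexx orbT andbT.
  by apply/orP; left; apply: ler_piMl; have := lamV_lt hl; lra.
have E0 : phi lambda false 0 = 0 by rewrite (phiE hl) mulr0 addr0.
have E1 : phi lambda true 1 = 1 by rewrite (phiE hl) mulr1 mulr1n addrC subrK.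
have [Pa|Pa] := pselect (P (phi lambda false 1)); last first.
  by apply: (shrink false); apply: (IH (fun x => P (phi lambda false x))) => //; rewrite E0.
have [Pb|Pb] := pselect (P (phi lambda true 0)).
  by apply: (shrink true); apply: (IH (fun x => P (phi lambda true x))) => //; rewrite E1.
exists (phi lambda false 1), (phi lambda true 0); split=> //.
- by apply: (cantor_phi hl); exact: (cantor1 hl).
- by apply: (cantor_phi hl); exact: (cantor0 hl).
- rewrite le_max !(phiE hl) /= mulr0n mulr1n mulr0 mulr1 add0r addr0.
  by rewrite ger0_norm; have := lamV_lt hl; lra.
Qed.

Lemma last_true (P : nat -> Prop) M : P 0%N -> ~ P M -> exists m, P m /\ ~ P m.+1.
Proof.
move=> P0; elim: M => // M IH PM; have [/IH//|nP] := pselect (~ P M).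
by exists M; split=> //; apply: contrapT.
Qed.

(** Take the longest word T whose interval contains E.  Then E meets both halves
    of that interval, so it jumps across its central gap; as E is close to an
    affine copy of C with factor gam, whose gaps are at most gam times the
    central gap of C, the interval of T is hardly longer than gam.  It is not
    shorter either since it contains E, so the copy of C is close to the piece
    of C coded by T.  All points of that piece are then close to E, and belong
    to E by the last hypothesis. *)
Lemma affine_copy (E : set R) (beta gam eta : R) :
  E `<=` C -> 0 < eta -> 4 * eta < gam * g0 ->
  (forall e, E e -> exists2 t, C t & `|e - (beta + gam * t)| <= eta) ->
  (forall t, C t -> exists2 e, E e & `|e - (beta + gam * t)| <= eta) ->
  (forall z e, C z -> E e -> `|z - e| <= 6 / g0 * eta -> E z) ->
  exists T, [/\ forall e, E e <-> (exists2 z, C z & e = phi_word lambda T z),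
    `|gam - lambda^-1 ^+ size T| <= 3 / g0 * eta &
    forall t, 0 <= t <= 1 -> `|beta + gam * t - phi_word lambda T t| <= 5 / g0 * eta].
Proof.
move=> EC eta0 small near1 near2 clop.
have gp := gap_gt0; have g1 := gap_lt1; have l0 := lamV_gt0 hl; have l2 := lamV_lt hl.
have gam0 : 0 < gam by rewrite -(pmulr_lgt0 _ gp); lra.
have gam2 : 2 * eta < gam by nra.
have [e0 Ee0 he0] := near2 0 (cantor0 hl); have [e1 Ee1 he1] := near2 1 (cantor1 hl).
move: he0 he1; rewrite mulr0 addr0 mulr1 !ler_norml => /andP[a1 a2] /andP[a3 a4].
pose W m := exists T, size T = m /\ forall e, E e -> exists2 z, C z & e = phi_word lambda T z.
have W0 : W 0%N by exists [::]; split=> // e Ee; exists e => //; exact: EC.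
have gap2 : 0 < gam - 2 * eta by lra.
have [M hM] := lamVX_small hl gap2.
have WM : ~ W M.
  move=> [T [sT hT]]; have [z0 Cz0 E0] := hT _ Ee0; have [z1 Cz1 E1] := hT _ Ee1.
  have := phi_word_dist hl T (cantor_I hl Cz1) (cantor_I hl Cz0).
  have := hM M (leqnn M); rewrite sT -E0 -E1 ler_norml => h /andP[_ h2]; lra.
have [m [[T [sT hT]] nW]] := last_true W0 WM.
pose L := lambda^-1 ^+ m; pose tau := phi_word lambda T 0.
have L0 : 0 < L by exact: lamVX_gt0.
have TE z : phi_word lambda T z = L * z + tau by rewrite (phi_wordE hl) sT.
pose half b e := exists2 z, C z & e = phi_word lambda T (phi lambda b z).
have halves e : E e -> half false e \/ half true e.
  move=> /hT[z /(cantor_split hl)[[] [y [Cy ->]]] ->]; first by right; exists y.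
  by left; exists y.
have meets b : exists2 e, E e & half b e.
  apply: contrapT => h; apply: nW; exists (rcons T (~~ b)); rewrite size_rcons sT; split=> // e Ee.
  have [z Cz Ez] : half (~~ b) e.
    have [h1|h1] := halves _ Ee; case: b h => // h; first by case: h; exists e.
    by case: h; exists e.
  by exists z => //; rewrite phi_word_rcons.
have halfF e : half false e -> tau <= e <= tau + L * lambda^-1.
  move=> [z Cz ->]; rewrite TE (phiE hl) addr0.
  have /andP[z0 z1] := cantor_I hl Cz.
  have h1 : 0 <= lambda^-1 * z by rewrite mulr_ge0// ltW.
  have h2 : lambda^-1 * z <= lambda^-1 by rewrite ger_pMr.
  by apply/andP; split; nra.
have halfT e : half true e -> tau + L * (1 - lambda^-1) <= e <= tau + L.
  move=> [z Cz ->]; rewrite TE (phiE hl) mulr1n.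
  have /andP[z0 z1] := cantor_I hl Cz.
  have h1 : 0 <= lambda^-1 * z by rewrite mulr_ge0// ltW.
  have h2 : lambda^-1 * z <= lambda^-1 by rewrite ger_pMr.
  by apply/andP; split; nra.
have ET e : E e -> tau <= e <= tau + L.
  move=> /halves[/halfF|/halfT] /andP[h1 h2]; apply/andP; split; nra.
have Elow e : E e -> beta - eta <= e.
  move=> /near1[t Ct]; rewrite ler_norml => /andP[h1 h2]; have := cantor_ge0 hl Ct; nra.
have Ehigh e : E e -> e <= beta + gam + eta.
  move=> /near1[t Ct]; rewrite ler_norml => /andP[h1 h2]; have := cantor_le1 hl Ct; nra.
have /andP[e0l e0h] := ET _ Ee0; have /andP[e1l e1h] := ET _ Ee1.
have Lge : gam - 2 * eta <= L by lra.
have L2 : 2 * eta < L * g0 by nra.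
have e0F : half false e0.
  have [//|/halfT/andP[h1 h2]] := halves _ Ee0.
  by have [e Ee /halfF/andP[h3 h4]] := meets false; have := Elow _ Ee; nra.
have e1T : half true e1.
  have [/halfF/andP[h1 h2]|//] := halves _ Ee1.
  by have [e Ee /halfT/andP[h3 h4]] := meets true; have := Ehigh _ Ee; nra.
have ex t : exists e, C t -> E e /\ `|e - (beta + gam * t)| <= eta.
  have [/near2[e Ee he]|nC] := pselect (C t); first by exists e.
  by exists 0.
have [ee hee] := choice ex.
have FT e : half false e -> ~ half true e.
  by move=> /halfF/andP[h1 h2] /halfT/andP[h3 h4]; nra.
have P0 : half false (ee 0).
  have [E0 h0] := hee _ (cantor0 hl); have [//|/halfT/andP[h1 h2]] := halves _ E0.
  move: h0; rewrite mulr0 addr0 ler_norml => /andP[h3 h4].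
  by have [e Ee /halfF/andP[h5 h6]] := meets false; have := Elow _ Ee; nra.
have P1 : ~ half false (ee 1).
  move=> /halfF/andP[h1 h2]; have [E0 h0] := hee _ (cantor1 hl).
  move: h0; rewrite mulr1 ler_norml => /andP[h3 h4].
  by have [e Ee /halfT/andP[h5 h6]] := meets true; have := Ehigh _ Ee; nra.
have [M' hM'] := lamVX_small hl gp.
have [s [t [Cs Ct Ps Pt st]]] := dichotomy_gap M' (P := fun x => half false (ee x)) P0 P1.
have {}st : t - s <= g0.
  apply: le_trans (ler_norm _) _; apply: le_trans st _.
  by rewrite ge_max lexx ltW// hM'.
have Lle : L * g0 <= gam * g0 + 2 * eta.
  have [Es hs] := hee _ Cs; have [Et ht] := hee _ Ct.
  have /andP[h1 h2] := halfF _ Ps.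
  have [//|/halfT/andP[h3 h4]] := halves _ Et.
  move: hs ht; rewrite !ler_norml => /andP[h5 h6] /andP[h7 h8].
  have h9 : gam * (t - s) <= gam * g0 by rewrite ler_pM2l.
  by nra.
have K0 : 0 < g0^-1 by rewrite invr_gt0.
pose k := eta / g0.
have kE : k * g0 = eta by rewrite /k mulfVK// gt_eqF.
have k0 : 0 < k by rewrite /k divr_gt0.
have ek : eta <= k by rewrite -kE ger_pMr// ltW.
have kd c : c / g0 * eta = c * k by rewrite /k; ring.
have Lgam : L <= gam + 2 * k.
  by rewrite -(ler_pM2r gp); move: Lle; rewrite -kE; lra.
have gL : `|gam - L| <= 3 * k by rewrite ler_norml; apply/andP; split; lra.
have bt t' : 0 <= t' <= 1 -> `|beta + gam * t' - phi_word lambda T t'| <= 5 * k.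
  move=> /andP[t0 t1]; rewrite TE.
  have -> : beta + gam * t' - (L * t' + tau) =
    (beta - tau) * (1 - t') + (beta + gam - (tau + L)) * t' by ring.
  have b1 : - k <= beta - tau <= 3 * k by apply/andP; split; lra.
  have b2 : - (3 * k) <= beta + gam - (tau + L) <= k by apply/andP; split; lra.
  case/andP: b1 => b1 b1'; case/andP: b2 => b2 b2'.
  by rewrite ler_norml; apply/andP; split; nra.
exists T; rewrite !kd sT; split=> // e.
split=> [/hT//|[z Cz ->]].
have [e1' Ee1' he1'] := near2 z Cz.
apply: (clop _ e1') => //; first exact: (cantor_word hl).
rewrite kd distrC -(subrKA (beta + gam * z)).
apply: le_trans (ler_normD _ _) _; have := bt z (cantor_I hl Cz); lra.
Qed.

End AffineCopy.

(** * Rigidity: the map is a signed permutation on small cubes *)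

Lemma common_lower_bound {R : realType} n (c : 'I_n -> R) :
  (forall i, 0 < c i) -> exists2 c0, 0 < c0 & forall i, c0 <= c i.
Proof.
move=> h; have s0 : 0 <= \sum_i (c i)^-1 by apply: sumr_ge0 => i _; rewrite invr_ge0 ltW.
exists (1 + \sum_i (c i)^-1)^-1; first by rewrite invr_gt0 ltr_pwDl.
move=> i; rewrite -[leRHS]invrK lef_pV2 ?posrE ?invr_gt0// ?ltr_pwDl//.
rewrite (bigD1 i)//= addrCA lerDl addr_ge0// sumr_ge0// => j _.
by rewrite invr_ge0 ltW.
Qed.

Section LocalRigidity.
Context {R : realType} {n : nat} (lambda : R) (hl : 2 < lambda).
Implicit Types (p q x y : 'rV[R]_n) (W T : dyadic_box n) (i : 'I_n).
Local Notation C := (cantor lambda).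
Local Notation Cn := (@cantor_power R lambda n).
Local Notation g0 := (1 - 2 * lambda^-1).

Lemma six_gap_ge0 : 0 <= 6 / g0.
Proof. by apply: divr_ge0 => //; exact: ltW (gap_gt0 hl). Qed.

Lemma six_gap1_ge0 : 0 <= 6 / g0 + 1.
Proof. by apply: addr_ge0 => //; exact: six_gap_ge0. Qed.

Definition has_depth m W : Prop := forall i, size (W i) = m.

Lemma cantor_power_box W y : Cn y -> Cn (box_map lambda W y).
Proof. by move=> Cy i; rewrite mxE; apply: (cantor_word hl); exact: Cy. Qed.

Lemma cantor_power_depth m x : Cn x ->
  exists W y, [/\ has_depth m W, Cn y & x = box_map lambda W y].
Proof.
move=> Cx; have [w hw] := choice (fun i => word_prefix hl m (Cx i)).
have [y hy] := choice hw; exists [ffun i => w i], (\row_i y i); split.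
- by move=> i; rewrite ffunE; case: (hy i).
- by move=> i; rewrite mxE; case: (hy i).
- by apply/rowP => i; rewrite !mxE ffunE; case: (hy i).
Qed.

Lemma cantor_power0 : Cn 0.
Proof. by move=> i; rewrite mxE; exact: (cantor0 hl). Qed.

Lemma flip_cantor b z : C z -> C (flip b z).
Proof. by case: b => //= Cz; exact: (cantor_onem hl). Qed.

Lemma signed_perm_cantor s e y : Cn y -> Cn (signed_perm s e y).
Proof. by move=> Cy i; rewrite signed_permE; apply: flip_cantor; exact: Cy. Qed.

Lemma flip_phi e b z : flip e (phi lambda b z) = phi lambda (e (+) b) (flip e z).
Proof. by case: e => //=; rewrite -(phi_onem hl). Qed.

Lemma box_map_dist m W x y : has_depth m W -> Cn x -> Cn y ->
  `|box_map lambda W x - box_map lambda W y| <= lambda^-1 ^+ m.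
Proof.
move=> hW Cx Cy; apply: mx_norm_le => [|a i]; first by rewrite ltW// (lamVX_gt0 hl).
rewrite !ord1 !mxE -(hW i).
by apply: (phi_word_dist hl); apply: (cantor_I hl); [exact: Cx|exact: Cy].
Qed.

Context (Phi Psi : 'rV[R]_n -> 'rV[R]_n).
Hypotheses (PhiK : cancel Phi Psi) (PsiK : cancel Psi Phi).
Hypotheses (PhiC : forall x, Cn x -> Cn (Phi x)) (PsiC : forall x, Cn x -> Cn (Psi x)).

Definition rigid W : Prop := exists T s e, ~~ parity s e /\
  forall y, Cn y -> Phi (box_map lambda W y) = box_map lambda T (signed_perm s e y).

(* On the ball of radius rho about p, Phi is eps-close to a signed permutation
   with scaling factors c, and Psi is Kp-Lipschitz near the image. *)
Context (p : 'rV[R]_n) (s : 'S_n) (e : 'I_n -> bool) (c : 'I_n -> R).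
Context (eps rho rho' Kp : R).
Hypotheses (ev : ~~ parity s e) (c0 : forall i, 0 < c i) (eps0 : 0 < eps).
Hypothesis (small1 : forall i, 27 * eps <= c i * g0 ^+ 2).
Hypothesis (small2 : Kp * ((6 / g0 + 1) * eps) < lambda - 2).
Hypothesis (Kp0 : 0 < Kp).
Hypothesis (strict : forall x y, `|x - p| < rho -> `|y - p| < rho -> forall i,
  `|Phi x ord0 i - Phi y ord0 i - (-1) ^+ e i * c i * (x - y) ord0 (s i)| <= eps * `|x - y|).
Hypothesis (lip : forall x y, `|x - p| < rho -> `|y - Phi x| <= rho' ->
  `|Psi y - x| <= Kp * `|y - Phi x|).

Definition in_region m W : Prop := [/\ has_depth m W,
  forall y, Cn y -> `|box_map lambda W y - p| < rho &
  (6 / g0 + 1) * eps * lambda^-1 ^+ m <= rho'].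

(** T i codes the projection of Phi(Q) to the i-th axis, Q the cube coded by W.
    The last two clauses compare its length and its parametrization with those
    predicted by the differential, with an error proportional to the side of Q. *)
Definition target m W T : Prop := forall i,
  [/\ forall y, Cn y -> exists2 z, C z & Phi (box_map lambda W y) ord0 i = phi_word lambda (T i) z,
      forall z, C z -> exists2 y, Cn y & Phi (box_map lambda W y) ord0 i = phi_word lambda (T i) z,
      `|c i * lambda^-1 ^+ m - lambda^-1 ^+ size (T i)| <= 3 / g0 * (eps * lambda^-1 ^+ m) &
      forall y, Cn y -> `|Phi (box_map lambda W y) ord0 i -
         phi_word lambda (T i) (signed_perm s e y ord0 i)| <= 6 / g0 * (eps * lambda^-1 ^+ m)].

Lemma approx_cube m W i y : in_region m W -> Cn y ->
  `|Phi (box_map lambda W y) ord0 i -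
    (Phi (box_map lambda W 0) ord0 i - c i * lambda^-1 ^+ m * (e i)%:R +
     c i * lambda^-1 ^+ m * signed_perm s e y ord0 i)| <= eps * lambda^-1 ^+ m.
Proof.
move=> [dW inW _] Cy; have C0 := cantor_power0.
have := strict (inW y Cy) (inW 0 C0) i.
set a := Phi _ ord0 i; set b := Phi (box_map lambda W 0) ord0 i => h.
have h2 := box_map_dist dW Cy C0.
have {h2} h2 := le_trans h (ler_wpM2l (ltW eps0) h2).
apply: le_trans h2; rewrite le_eqVlt; apply/orP; left; apply/eqP; congr (`|_|).
have -> : (box_map lambda W y - box_map lambda W 0) ord0 (s i) = lambda^-1 ^+ m * y ord0 (s i).
  by rewrite !mxE (phi_wordB hl) dW subr0.
rewrite signed_permE /flip; case: (e i) => /=; rewrite ?expr1 ?expr0; ring.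
Qed.

(** A point of the Cantor set whose coordinates are close to coordinates of
    points of Phi(Q), Q a small cube, lies in Phi(Q): the preimages of these
    points can be combined into a single point of Q, because each coordinate
    of Phi depends essentially on one coordinate. *)
Lemma image_is_box m W y : in_region m W -> Cn y ->
  (forall i, exists2 x, Cn x & `|y ord0 i - Phi (box_map lambda W x) ord0 i|
      <= 6 / g0 * (eps * lambda^-1 ^+ m)) ->
  exists2 x, Cn x & y = Phi (box_map lambda W x).
Proof.
move=> reg Cy; have [dW inW hrho'] := reg => hx.
have [f hf] := choice (fun i => let: ex_intro2 x a b := hx i in ex_intro _ x (conj a b)).
have l0 : 0 < lambda^-1 ^+ m by exact: lamVX_gt0.
pose x : 'rV[R]_n := \row_k f (s^-1%g k) ord0 k.
have Cx : Cn x by move=> k; rewrite mxE; have [h _] := hf (s^-1%g k); exact: h.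
have close i : `|Phi (box_map lambda W (f i)) ord0 i - Phi (box_map lambda W x) ord0 i|
    <= eps * lambda^-1 ^+ m.
  have [Cf _] := hf i; have := strict (inW _ Cf) (inW _ Cx) i.
  have -> : (box_map lambda W (f i) - box_map lambda W x) ord0 (s i) = 0.
    by rewrite !mxE permK subrr.
  rewrite mulr0 subr0 => /le_trans; apply.
  by rewrite ler_wpM2l ?(ltW eps0)//; exact: box_map_dist.
have dist : `|y - Phi (box_map lambda W x)| <= (6 / g0 + 1) * eps * lambda^-1 ^+ m.
  apply: mx_norm_le => [|a i].
    exact: (mulr_ge0 (mulr_ge0 six_gap1_ge0 (ltW eps0)) (ltW l0)).
  rewrite !ord1 mxE [X in _ + X]mxE -(subrKA (Phi (box_map lambda W (f i)) ord0 i)).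
  apply: le_trans (ler_normD _ _) _; have [_ h1] := hf i; have h2 := close i.
  by apply: le_trans (lerD h1 h2) _; rewrite le_eqVlt; apply/orP; left; apply/eqP; ring.
have h := lip (inW _ Cx) (le_trans dist hrho').
have lam2 : 0 < lambda - 2 by rewrite subr_gt0 hl.
have hPsi : `|Psi y - box_map lambda W x| < (lambda - 2) * lambda^-1 ^+ m.
  apply: le_lt_trans h _; apply: le_lt_trans (ler_wpM2l (ltW Kp0) dist) _.
  by rewrite mulrA ltr_pM2r.
have [W' [x' [dW' Cx' E]]] := cantor_power_depth m (PsiC Cy).
exists x' => //; rewrite -[LHS]PsiK E; congr (Phi (box_map _ _ _)).
apply/ffunP => i; apply: (near_same_word hl (x := x' ord0 i) (y := x ord0 i)).
- by rewrite dW dW'.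
- by apply: (cantor_I hl); exact: Cx'.
- by apply: (cantor_I hl); exact: Cx.
- rewrite dW'; apply: le_lt_trans hPsi; rewrite E.
  have := mx_entry_le (box_map lambda W' x' - box_map lambda W x) ord0 i.
  by rewrite !mxE.
Qed.

(** The projection of Phi(Q) to an axis is close to an affine copy of C and, by
    [image_is_box], contains the points of C close to it. *)
Lemma cube_image m W : in_region m W -> exists T, target m W T.
Proof.
move=> reg; have gp := gap_gt0 hl; have g1 := gap_lt1 hl.
have l0 : 0 < lambda^-1 ^+ m by exact: lamVX_gt0.
suff h i : exists T : seq bool, [/\
    forall y, Cn y -> exists2 z, C z & Phi (box_map lambda W y) ord0 i = phi_word lambda T z,
    forall z, C z -> exists2 y, Cn y & Phi (box_map lambda W y) ord0 i = phi_word lambda T z,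
    `|c i * lambda^-1 ^+ m - lambda^-1 ^+ size T| <= 3 / g0 * (eps * lambda^-1 ^+ m) &
    forall y, Cn y -> `|Phi (box_map lambda W y) ord0 i -
      phi_word lambda T (signed_perm s e y ord0 i)| <= 6 / g0 * (eps * lambda^-1 ^+ m)].
  have [T hT] := choice h; exists [ffun i => T i] => i; rewrite ffunE; exact: hT.
pose E : set R := [set a | exists2 y, Cn y & a = Phi (box_map lambda W y) ord0 i].
set gam := c i * lambda^-1 ^+ m.
pose beta := Phi (box_map lambda W 0) ord0 i - gam * (e i)%:R.
have eta0 : 0 < eps * lambda^-1 ^+ m by rewrite mulr_gt0.
have near y : Cn y -> `|Phi (box_map lambda W y) ord0 i - (beta + gam * signed_perm s e y ord0 i)|
    <= eps * lambda^-1 ^+ m by exact: approx_cube.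
have EC : E `<=` C by move=> _ [y Cy ->]; exact: (PhiC (cantor_power_box W Cy)).
have small : 4 * (eps * lambda^-1 ^+ m) < gam * g0.
  rewrite /gam mulrA [ltRHS]mulrAC ltr_pM2r//.
  have h : c i * g0 ^+ 2 <= c i * g0.
    by rewrite expr2 mulrA; apply: ler_piMr; [rewrite mulr_ge0 ?(ltW (c0 i))// ltW|exact: ltW].
  by have := le_trans (small1 i) h; move: eps0; lra.
have near1 a : E a -> exists2 t, C t & `|a - (beta + gam * t)| <= eps * lambda^-1 ^+ m.
  move=> [y Cy ->]; exists (signed_perm s e y ord0 i); last exact: near.
  exact: (signed_perm_cantor s e Cy i).
have near2 t : C t -> exists2 a, E a & `|a - (beta + gam * t)| <= eps * lambda^-1 ^+ m.
  move=> Ct; pose y : 'rV[R]_n := signed_perm s^-1 (fun i => e (s^-1%g i)) (const_mx t).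
  have Cy : Cn y by apply: signed_perm_cantor => k; rewrite mxE.
  exists (Phi (box_map lambda W y) ord0 i); first by exists y.
  by have := near y Cy; rewrite signed_permVK mxE.
have clop z a : C z -> E a -> `|z - a| <= 6 / g0 * (eps * lambda^-1 ^+ m) -> E z.
  move=> Cz [x Cx ->] zx.
  pose y : 'rV[R]_n := \row_k if k == i then z else Phi (box_map lambda W x) ord0 k.
  have Cy : Cn y.
    by move=> k; rewrite mxE; case: eqP => // _; exact: (PhiC (cantor_power_box W Cx)).
  have [k|x' Cx' Ex'] := image_is_box reg Cy.
    exists x => //; rewrite mxE; have [->//|_] := eqVneq k i.
    by rewrite subrr normr0 (mulr_ge0 six_gap_ge0 (ltW eta0)).
  by exists x' => //; rewrite -Ex' mxE eqxx.
have [T [TE Tgam Tbeta]] := affine_copy hl EC eta0 small near1 near2 clop.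
exists T; split=> //.
- by move=> y Cy; apply/TE; exists y.
- by move=> z Cz; have /TE[y Cy Ey] : exists2 z', C z' & phi_word lambda T z = phi_word lambda T z'
    by [exists z]; exists y.
- move=> y Cy; rewrite -(subrKA (beta + gam * signed_perm s e y ord0 i)).
  apply: le_trans (ler_normD _ _) _.
  have h1 := near y Cy; have h2 := Tbeta _ (cantor_I hl (signed_perm_cantor s e Cy i)).
  have kd (a : R) : a / g0 * (eps * lambda^-1 ^+ m) = a * (eps * lambda^-1 ^+ m / g0) by ring.
  rewrite !kd in h2 *.
  have h3 : eps * lambda^-1 ^+ m <= eps * lambda^-1 ^+ m / g0.
    by rewrite ler_pdivlMr//; exact: (ler_piMr (ltW eta0) (ltW g1)).
  lra.
Qed.

(** The lengths predicted for a cube and its subcube have ratio lambda up to a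
    small relative error, so the target word grows by exactly one digit.  The
    error on the position is smaller than the gap between the two possible
    subintervals, so this digit is the one given by the signed permutation. *)
Lemma target_child m W T b T' : in_region m W -> target m W T ->
  let W' : dyadic_box n := [ffun i => rcons (W i) (b i)] in
  target m.+1 W' T' -> forall i, T' i = rcons (T i) (e i (+) b (s i)).
Proof.
move=> reg tT W' tT' i; have gp := gap_gt0 hl; have g1 := gap_lt1 hl.
have l0 : 0 < lambda^-1 ^+ m by exact: lamVX_gt0.
have lv0 := lamV_gt0 hl; have lv2 := lamV_lt hl.
have [T1 _ Tlen Tapp] := tT i; have [_ T2 Tlen' Tapp'] := tT' i.
pose k := eps / g0.
have kE : k * g0 = eps by rewrite /k mulfVK// gt_eqF.
have k0 : 0 < k by rewrite /k divr_gt0.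
have kc : 27 * k <= c i * g0.
  by rewrite -(ler_pM2r gp) -mulrA kE -mulrA -expr2.
have kc' : 27 * k <= c i by apply: le_trans kc _; rewrite ger_pMr// ltW.
have kd (a d : R) : a / g0 * (eps * d) = a * k * d by rewrite /k; ring.
move: Tlen Tlen' Tapp; rewrite !kd exprS => Tlen Tlen' Tapp.
set l := lambda^-1 ^+ m in l0 Tlen Tlen' Tapp.
set a := lambda^-1 ^+ size (T i) in Tlen; set a' := lambda^-1 ^+ size (T' i) in Tlen'.
have [al ah] : a >= (c i - 3 * k) * l /\ a <= (c i + 3 * k) * l.
  by move: Tlen; rewrite ler_norml => /andP[? ?]; split; lra.
have [al' ah'] : a' >= (c i - 3 * k) * (lambda^-1 * l) /\ a' <= (c i + 3 * k) * (lambda^-1 * l).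
  by move: Tlen'; rewrite ler_norml => /andP[? ?]; split; lra.
have lexp u v : (u <= v)%N -> lambda^-1 ^+ v <= lambda^-1 ^+ u :> R.
  by move=> uv; apply: ler_wiXn2l => //; [exact: ltW|lra].
have ll0 : 0 < lambda^-1 * l by rewrite mulr_gt0.
have ll2 : lambda^-1 * l < 2^-1 * l by rewrite ltr_pM2r.
have c0i := c0 i.
have lt1 : (size (T i) < size (T' i))%N.
  rewrite ltnNge; apply/negP => /lexp; rewrite -/a -/a' => h.
  have h1 : (c i - 3 * k) * l <= (c i + 3 * k) * (2^-1 * l).
    apply: le_trans al _; apply: le_trans h _; apply: le_trans ah' _.
    by rewrite ler_wpM2l ?(ltW ll2)//; lra.
  have h2 : (c i - 3 * k) * l <= ((c i + 3 * k) * 2^-1) * l by rewrite -mulrA.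
  by move: h2; rewrite ler_pM2r//; lra.
have lt2 : (size (T' i) < (size (T i)).+2)%N.
  rewrite ltnNge; apply/negP => /lexp; rewrite -/a' !exprS -/a => h.
  have h1 : (c i - 3 * k) * (lambda^-1 * l) <= lambda^-1 * (lambda^-1 * ((c i + 3 * k) * l)).
    by apply: le_trans al' _; apply: le_trans h _; rewrite !ler_wpM2l// ltW.
  have h2 : (c i - 3 * k) * (lambda^-1 * l) <= lambda^-1 * (c i + 3 * k) * (lambda^-1 * l).
    by apply: le_trans h1 _; rewrite le_eqVlt; apply/orP; left; apply/eqP; ring.
  have h3 : lambda^-1 * (c i + 3 * k) <= 2^-1 * (c i + 3 * k).
    by rewrite ler_wpM2r ?(ltW lv2)//; lra.
  by move: h2; rewrite ler_pM2r//; lra.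
have sz : size (T' i) = (size (T i)).+1 by apply/eqP; rewrite eqn_leq lt1 andbT; exact: lt2.
case/lastP ET : (T' i) sz => [//|U d]; rewrite size_rcons => -[sU].
have boxW' y : box_map lambda W' y = box_map lambda W (\row_k phi lambda (b k) (y ord0 k)).
  by apply/rowP => k'; rewrite !mxE ffunE phi_word_rcons.
have childC y : Cn y -> Cn (\row_k phi lambda (b k) (y ord0 k)).
  by move=> Cy k'; rewrite mxE; apply: (cantor_phi hl); exact: Cy.
have UT : U = T i.
  have [y Cy] := T2 0 (cantor0 hl); rewrite boxW' ET phi_word_rcons.
  have [z Cz ->] := T1 _ (childC y Cy) => E.
  apply: (near_same_word hl (x := phi lambda d 0) (y := z)) => //.
  - by apply: phi01 => //; rewrite lexx ler01.
  - exact: (cantor_I hl Cz).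
  - by rewrite E subrr normr0 mulr_gt0 ?(lamVX_gt0 hl)// subr_gt0.
congr rcons => //; apply: contrapT => /eqP dd.
have {}dd : e i (+) b (s i) = ~~ d by move: dd; case: (e i (+) b (s i)); case: (d).
have C0 := cantor_power0.
have [z Cz Ez] : exists2 z, C z & Phi (box_map lambda W' 0) ord0 i = phi_word lambda (T' i) z.
  by have [h _ _ _] := tT' i; exact: h.
have := Tapp _ (childC 0 C0); rewrite -boxW' Ez ET phi_word_rcons UT signed_permE mxE flip_phi dd.
move=> h.
have := phi_sep hl d (cantor_I hl Cz) (flip01 (e i) (cantor_I hl (C0 (s i)))).
rewrite (phi_wordB hl) normrM gtr0_norm ?(lamVX_gt0 hl)// in h => h2.
have h3 : a * g0 <= 6 * k * l.
  by apply: le_trans h; rewrite ler_wpM2l// /a ltW// (lamVX_gt0 hl).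
have h4 : (c i - 3 * k) * l * g0 <= 6 * k * l.
  by apply: le_trans h3; rewrite ler_wpM2r// ltW.
have h5 : (c i - 3 * k) * g0 <= 6 * k by rewrite -(ler_pM2r l0) mulrAC.
by nra.
Qed.

Lemma in_region_child m W b : in_region m W ->
  in_region m.+1 ([ffun i => rcons (W i) (b i)] : dyadic_box n).
Proof.
move=> [dW inW hr]; split.
- by move=> i; rewrite ffunE size_rcons dW.
- move=> y Cy; have := inW (\row_k phi lambda (b k) (y ord0 k)).
  rewrite (_ : box_map _ _ _ = box_map lambda [ffun i => rcons (W i) (b i)] y); last first.
    by apply/rowP => k; rewrite !mxE ffunE phi_word_rcons.
  by apply=> k; rewrite mxE; apply: (cantor_phi hl); exact: Cy.
- apply: le_trans hr; rewrite exprS ler_wpM2l//.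
    exact: (mulr_ge0 six_gap1_ge0 (ltW eps0)).
  by rewrite ler_piMl ?(ltW (lamVX_gt0 hl _))//; have := lamV_lt hl; lra.
Qed.

(** The estimate at depth m + r holds at depth m as well, because the words of the
    target are compatible with the signed permutation of the digits. *)
Lemma target_error r m W T y i : in_region m W -> target m W T -> Cn y ->
  `|Phi (box_map lambda W y) ord0 i - phi_word lambda (T i) (signed_perm s e y ord0 i)|
    <= 6 / g0 * eps * lambda^-1 ^+ m * lambda^-1 ^+ r.
Proof.
elim: r m W T y => [|r IH] m W T y reg tT Cy.
  by rewrite expr0 mulr1 -mulrA; have [_ _ _ h] := tT i; exact: h.
have [b hb] := choice (fun k => cantor_split hl (Cy k)).
have [y' hy'] := choice hb.
have Cy' : Cn (\row_k y' k) by move=> k; rewrite mxE; case: (hy' k).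
have reg' := in_region_child b reg; have [T' tT'] := cube_image reg'.
have := IH _ _ _ _ reg' tT' Cy'.
rewrite (target_child reg tT tT') phi_word_rcons signed_permE mxE -flip_phi.
have [_ <-] := hy' (s i); rewrite -(signed_permE s e y).
rewrite (_ : box_map _ _ _ = box_map lambda W y); last first.
  apply/rowP => k; rewrite !mxE ffunE phi_word_rcons.
  by have [_ <-] := hy' k.
by rewrite -!mulrA -!exprD addSnnS.
Qed.

Lemma rigid_in_region m W : in_region m W -> rigid W.
Proof.
move=> reg; have [T tT] := cube_image reg; exists T, s, e; split=> // y Cy.
apply/rowP => i; rewrite [RHS]mxE; apply/eqP; rewrite -subr_eq0; apply/eqP.
by apply: (small_eq0 hl) => r; exact: (target_error r i reg tT Cy).
Qed.

End LocalRigidity.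

(** * Rigidity: uniformity of the depth *)

Section UniformRigidity.
Context {R : realType} {n : nat} (lambda : R) (hl : 2 < lambda).
Implicit Types (p q x y : 'rV[R]_n) (W T : dyadic_box n).
Local Notation C := (cantor lambda).
Local Notation Cn := (@cantor_power R lambda n).
Local Notation g0 := (1 - 2 * lambda^-1).

Lemma C1_lipschitz (f : 'rV[R]_n -> 'rV[R]_n) q : C1 f ->
  exists K r, [/\ 0 < K, 0 < r & forall x y, `|x - q| < r -> `|y - q| < r ->
    `|f x - f y| <= K * `|x - y|].
Proof.
move=> Cf; have [r r0 h] := C1_strict q Cf ltr01.
exists (n%:R * `|jacobian f q| + 1), r.
have K0 : 0 < n%:R * `|jacobian f q| + 1 by rewrite ltr_wpDl// mulr_ge0.
split=> // x y xq yq; apply: mx_norm_le => [|a j]; first by rewrite mulr_ge0// ltW.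
have := h x y xq yq j; have := mx_norm_mulr_le (x - y) (jacobian f q) j.
have -> : (f x - f y) a j = f x ord0 j - f y ord0 j by rewrite ord1 !mxE.
move: (((x - y) *m jacobian f q) ord0 j) => t h1 h2.
rewrite -(subrK t (_ - _)); apply: le_trans (ler_normD _ _) _.
apply: le_trans (lerD h2 h1) _; rewrite le_eqVlt; apply/orP; left; apply/eqP; ring.
Qed.

Context (Phi Psi : 'rV[R]_n -> 'rV[R]_n).
Hypotheses (CPhi : C1 Phi) (CPsi : C1 Psi) (PhiK : cancel Phi Psi) (PsiK : cancel Psi Phi).
Hypotheses (PhiC : forall x, Cn x -> Cn (Phi x)) (PsiC : forall x, Cn x -> Cn (Psi x)).
Hypothesis orPhi : orientation_preserving Phi.

Lemma rigid_near p : Cn p -> exists2 r, 0 < r & exists M, forall x m W y,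
  `|x - p| < r -> (M <= m)%N -> has_depth m W -> Cn y -> x = box_map lambda W y ->
  rigid lambda Phi W.
Proof.
move=> Cp; have gp := gap_gt0 hl.
have [s [e [c [ev c0 JE]]]] := jacobian_on_cantor hl CPhi CPsi PhiK PhiC PsiC orPhi Cp.
have [c1 c10 hc1] := common_lower_bound c0.
have [K [r2 [K0 r20 lipPsi]]] := C1_lipschitz (Phi p) CPsi.
have s1 : 0 < 6 / g0 + 1 by have := six_gap_ge0 hl; lra.
(* The two bounds on eps ensure small1 and small2: the first makes the errors
   small compared with the gaps of the targets, the second keeps the preimages
   of nearby points of C^n in the same cube. *)
pose eps := Num.min (c1 * g0 ^+ 2 / 27) ((lambda - 2) / (2 * (K * (6 / g0 + 1)))).
have lam2 : 0 < lambda - 2 by rewrite subr_gt0.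
have eps0 : 0 < eps.
  by rewrite lt_min !divr_gt0// ?mulr_gt0// exprn_gt0.
have small1 i : 27 * eps <= c i * g0 ^+ 2.
  apply: (@le_trans _ _ (c1 * g0 ^+ 2)); last by rewrite ler_wpM2r ?exprn_ge0 ?(ltW gp).
  by rewrite mulrC -ler_pdivlMr// ge_min lexx.
have small2 : K * ((6 / g0 + 1) * eps) < lambda - 2.
  apply: (@le_lt_trans _ _ ((lambda - 2) / 2)); last by rewrite ltr_pdivrMr//; lra.
  rewrite mulrA mulrC -ler_pdivlMr ?mulr_gt0//.
  by rewrite -mulrA -invfM /eps ge_min lexx orbT.
have [r1 r10 strict] := C1_strict p CPhi eps0.
have cPhi := C1_continuous CPhi.
have r22 : 0 < r2 / 2 by rewrite divr_gt0.
have /cvgrPdist_lt/(_ _ r22)/nbhs_ballP[r3 /= r30 h3] := cPhi p.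
pose rho := Num.min r1 r3.
have rho0 : 0 < rho by rewrite lt_min r10.
have strict' x y : `|x - p| < rho -> `|y - p| < rho -> forall i,
    `|Phi x ord0 i - Phi y ord0 i - (-1) ^+ e i * c i * (x - y) ord0 (s i)| <= eps * `|x - y|.
  rewrite !lt_min => /andP[xp _] /andP[yp _] i.
  by have := strict x y xp yp i; rewrite JE.
have lip x y : `|x - p| < rho -> `|y - Phi x| <= r2 / 2 -> `|Psi y - x| <= K * `|y - Phi x|.
  rewrite lt_min => /andP[_ xp] yx; rewrite -{1}(PhiK x).
  have h := h3 x; rewrite -ball_normE /= distrC in h; have {}h := h xp.
  have Phx : `|Phi x - Phi p| < r2 / 2 by rewrite distrC.
  apply: lipPsi.
    rewrite -(subrKA (Phi x)); apply: le_lt_trans (ler_normD _ _) _.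
    by rewrite (splitr r2) ler_ltD.
  by apply: lt_trans Phx _; rewrite ltr_pdivrMr//; lra.
exists (rho / 2); first by rewrite divr_gt0.
pose d := Num.min (rho / 2) (r2 / 2 / ((6 / g0 + 1) * eps)).
have d0 : 0 < d by rewrite lt_min !divr_gt0// mulr_gt0.
have [M hM] := lamVX_small hl d0.
exists M => x m W y xp Mm dW Cy Ex.
have := hM m Mm; rewrite lt_min => /andP[m1 m2].
apply: (rigid_in_region hl PsiK PhiC PsiC ev c0 eps0 small1 small2 K0 strict' lip (m := m)).
split=> //; last by rewrite mulrC -ler_pdivlMr ?mulr_gt0// ltW.
move=> y' Cy'; rewrite -(subrKA x); apply: le_lt_trans (ler_normD _ _) _.
rewrite (splitr rho) ler_ltD// Ex; apply: le_trans (ltW m1); exact: (box_map_dist hl).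
Qed.

Lemma rigid_uniform : exists m, forall W, has_depth m W -> rigid lambda Phi W.
Proof.
have cptC : compact Cn.
  apply: (@rV_compact R n (fun=> C)) => i; exact: (cantor_compact hl).
have /compact_near_coveringP cov := cptC.
have [|m _ hm] := cov nat \oo (fun m x => forall W y, has_depth m W -> Cn y ->
    x = box_map lambda W y -> rigid lambda Phi W) _.
  move=> p Cp; have [r r0 [M h]] := rigid_near Cp.
  exists (ball p r, [set m | (M <= m)%N]).
    split=> /=; first exact: nbhsx_ballx.
    by exists M.
  move=> [x m] /= [xp Mm] W y; apply: h => //.
  by move: xp; rewrite -ball_normE /= distrC.
exists m => W dW; have C0 := cantor_power0 hl (n := n).
exact: (hm m (leqnn m) (box_map lambda W 0) (cantor_power_box hl W C0) W 0 dW C0).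
Qed.

End UniformRigidity.

(** * Refinement of patterns *)

Section Refine.
Context {n : nat}.
Implicit Types (L : dyadic_box n) (P : seq (dyadic_box n)).

(** The index k of good bounds the number of halvings still needed; the boxes
    are treated one at a time, which leaves the others unchanged. *)
Lemma refine_pattern (good : nat -> dyadic_box n -> Prop) :
  (forall k L, good k.+1 L -> exists i, forall b, good k (half_box L i b)) ->
  forall P, pattern P -> (forall L, L \in P -> exists k, good k L) ->
  exists2 P', pattern P' & forall L, L \in P' -> good 0%N L.
Proof.
move=> halve.
have refine_box k L P1 P2 : good k L -> pattern (P1 ++ L :: P2) ->
    exists2 X, pattern (P1 ++ X ++ P2) & forall L', L' \in X -> good 0%N L'.
  elim: k L P1 P2 => [|k IH] L P1 P2 gL pP.
    by exists [:: L] => // L'; rewrite inE => /eqP->.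
  have [i hi] := halve _ _ gL.
  have [X1 pX1 gX1] := IH _ _ _ (hi false) (pattern_halve i pP).
  rewrite catA in pX1; have [X2 pX2 gX2] := IH _ _ _ (hi true) pX1.
  exists (X1 ++ X2); first by rewrite -catA; move: pX2; rewrite -catA.
  by move=> L'; rewrite mem_cat => /orP[/gX1|/gX2].
suff all P X : pattern (X ++ P) -> (forall L, L \in X -> good 0%N L) ->
    (forall L, L \in P -> exists k, good k L) ->
    exists2 P', pattern P' & forall L, L \in P' -> good 0%N L.
  by move=> P pP gP; exact: (all P [::]).
elim: P X => [|L P IH] X pP gX gP; first by exists X; [rewrite cats0 in pP|].
have [|k gk] := gP L; first by rewrite mem_head.
have [Y pY gY] := refine_box k L X P gk pP.
apply: (IH (X ++ Y)); first by rewrite -catA.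
  by move=> L'; rewrite mem_cat => /orP[/gX|/gY].
by move=> L' LP; apply: gP; rewrite inE LP orbT.
Qed.

(** The number of halvings that are missing to reach depth M. *)
Definition deficit M L : nat := \sum_i (M - size (L i)).

Lemma deficit0 M L : deficit M L = 0%N -> (forall i, size (L i) <= M)%N ->
  has_depth M L.
Proof.
move=> /eqP; rewrite sum_nat_eq0 => /forallP h le i; apply/eqP.
by have := h i; rewrite implyTb subn_eq0 eqn_leq le.
Qed.

Lemma deficit_half k M L : deficit M L = k.+1 -> (forall i, size (L i) <= M)%N ->
  exists i, forall b, deficit M (half_box L i b) = k /\
    forall j, (size (half_box L i b j) <= M)%N.
Proof.
move=> dk le.
have [i iM|h] := pickP (fun i => size (L i) < M)%N; last first.
  suff : deficit M L = 0%N by rewrite dk.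
  by apply: big1 => i _; apply/eqP; rewrite subn_eq0 leqNgt h.
exists i => b; split=> [|j]; last first.
  by rewrite ffunE; case: eqP => [->|_]; rewrite ?size_rcons.
have E : deficit M (half_box L i b) =
    (M - (size (L i)).+1 + \sum_(j < n | j != i) (M - size (L j)))%N.
  rewrite /deficit (bigD1 i)//= ffunE eqxx size_rcons; congr addn.
  by apply: eq_bigr => j /negbTE ji; rewrite ffunE ji.
by move: dk; rewrite E /deficit (bigD1 i)//= -(subnSK (iM : (size (L i) < M)%N)) addSn => -[].
Qed.

Lemma grid_pattern M : exists2 P : seq (dyadic_box n), pattern P & forall L, L \in P -> has_depth M L.
Proof.
have [|L|P pP gP] := @refine_pattern
  (fun k L => deficit M L = k /\ forall i, size (L i) <= M)%N _ _ (@pattern_cube n).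
- move=> k L [dk le]; exact: deficit_half.
- by rewrite inE => /eqP->; exists (deficit M [ffun=> [::]]); split=> // i; rewrite ffunE.
- by exists P => // L /gP[d le]; exact: deficit0.
Qed.

End Refine.

Section PatternGeometry.
Context {R : realType} {n : nat} (lambda : R) (hl : 2 < lambda) (hn : (1 < n)%N).
Implicit Types (x y : 'rV[R]_n) (L T U : dyadic_box n) (P Q : seq (dyadic_box n)).
Local Notation Cn := (@cantor_power R lambda n).

Lemma cantor_power_cube y : Cn y -> unit_cube y.
Proof. by move=> Cy; apply/unit_cubeP => i; apply: (cantor_I hl); exact: Cy. Qed.

Lemma slot_inj k k' y y' : unit_cube y -> unit_cube y' -> y + slot k = y' + slot k' -> k = k'.
Proof.
move=> /unit_cubeP cy /unit_cubeP cy' /rowP/(_ (Ordinal (ltnW hn))).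
rewrite !slotE; have /andP[a b] := cy (Ordinal (ltnW hn)).
have /andP[c d] := cy' (Ordinal (ltnW hn)) => E.
have [lt|lt|//] := ltngtP k k'.
  have : (k%:R + 1 <= k'%:R :> R) by rewrite natr1 ler_nat.
  by move=> h; exfalso; lra.
have : (k'%:R + 1 <= k%:R :> R) by rewrite natr1 ler_nat.
by move=> h; exfalso; lra.
Qed.

(** The spreading diffeomorphism carries the boxes to disjoint cubes. *)
Lemma pattern_nth_inj P k k' y y' : pattern P -> (k < size P)%N -> (k' < size P)%N ->
  unit_cube y -> unit_cube y' ->
  box_map lambda (nth [ffun=> [::]] P k) y = box_map lambda (nth [ffun=> [::]] P k') y' -> k = k'.
Proof.
move=> pP kP kP' cy cy' E; have [F _ hF] := pattern_spread hl hn pP.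
by apply: (slot_inj cy cy'); rewrite -!hF// E.
Qed.

Lemma unit_cube0 : unit_cube (0 : 'rV[R]_n).
Proof. by apply/unit_cubeP => i; rewrite mxE lexx ler01. Qed.

Lemma pattern_uniq P : pattern P -> uniq P.
Proof.
move=> pP; apply/(uniqP [ffun=> [::]]) => k k'; rewrite !inE => kP kP' E.
by apply: (pattern_nth_inj pP kP kP' unit_cube0 unit_cube0); rewrite E.
Qed.

Lemma pattern_disjoint P L L' y y' : pattern P -> L \in P -> L' \in P ->
  unit_cube y -> unit_cube y' -> box_map lambda L y = box_map lambda L' y' -> L = L'.
Proof.
move=> pP LP LP' cy cy' E; rewrite -(nth_index [ffun=> [::]] LP) -(nth_index [ffun=> [::]] LP').
congr nth; apply: (pattern_nth_inj pP (y := y) (y' := y')); rewrite ?index_mem//.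
by rewrite !nth_index.
Qed.

Lemma pattern_cover P x : pattern P -> Cn x ->
  exists L y, [/\ L \in P, Cn y & x = box_map lambda L y].
Proof.
move=> pP Cx; elim: pP => {P} [|P1 L P2 i _ [L' [y [LP Cy E]]]|P Q PQ _ [L [y [LP Cy E]]]].
- exists [ffun=> [::]], x; split=> //; first by rewrite mem_head.
  by apply/rowP => i; rewrite mxE ffunE.
- move: LP; rewrite mem_cat inE => /or3P[LP|/eqP EL|LP].
  + by exists L', y; rewrite mem_cat LP.
  + have [b [z [Cz yz]]] := cantor_split hl (Cy i).
    exists (half_box L i b), (\row_k if k == i then z else y ord0 k); split.
    * by rewrite mem_cat !inE; case: b {yz}; rewrite eqxx ?orbT.
    * by move=> k; rewrite mxE; case: eqP => // _; exact: Cy.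
    * rewrite E EL box_map_half; congr (box_map _ _ _); apply/rowP => k; rewrite !mxE.
      by have [->|//] := eqVneq k i.
  + by exists L', y; rewrite mem_cat !inE LP !orbT.
- by exists L, y; rewrite -(perm_mem PQ).
Qed.

Lemma box_map_eq_depth M L L' y y' : has_depth M L -> has_depth M L' ->
  unit_cube y -> unit_cube y' -> box_map lambda L y = box_map lambda L' y' -> L = L'.
Proof.
move=> dL dL' /unit_cubeP cy /unit_cubeP cy' /rowP E; apply/ffunP => i.
apply: (near_same_word hl _ (cy i) (cy' i)); first by rewrite dL dL'.
have := E i; rewrite !mxE => ->; rewrite subrr normr0 mulr_gt0 ?(lamVX_gt0 hl)//.
by rewrite subr_gt0.
Qed.

Lemma signed_perm_half s e i b y : signed_perm s e (half_map lambda (s i) b y) =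
  half_map lambda i (e i (+) b) (signed_perm s e y).
Proof.
apply/rowP => k; rewrite !mxE (inj_eq perm_inj).
by have [->|_] := eqVneq k i; rewrite ?(flip_phi hl).
Qed.

Context (Phi Psi : 'rV[R]_n -> 'rV[R]_n).
Hypotheses (PhiK : cancel Phi Psi) (PsiK : cancel Psi Phi).
Hypothesis PsiC : forall x, Cn x -> Cn (Psi x).

Definition sends L T s e : Prop := ~~ parity s e /\
  forall y, Cn y -> Phi (box_map lambda L y) = box_map lambda T (signed_perm s e y).

(** The i-th coordinate of the image is a function of coordinate s i of the
    source, and the two halves are exchanged when it is decreasing. *)
Lemma sends_half L T s e i b : sends L T s e ->
  sends (half_box L (s i) b) (half_box T i (e i (+) b)) s e.
Proof.
move=> [ev h]; split=> // y Cy; rewrite !box_map_half h ?signed_perm_half// => k.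
by rewrite mxE; case: eqP => _; [apply: (cantor_phi hl)|]; exact: Cy.
Qed.

Lemma sends_refine M P : pattern P ->
  (forall L, L \in P -> exists T s e, sends L T s e /\ forall i, (size (T i) <= M)%N) ->
  exists2 P', pattern P' &
    forall L, L \in P' -> exists T s e, sends L T s e /\ has_depth M T.
Proof.
move=> pP hP.
have [|L LP|P' pP' gP'] := @refine_pattern n (fun k L => exists T s e,
    [/\ sends L T s e, deficit M T = k & forall i, size (T i) <= M]%N) _ P pP.
- move=> k L [T [s [e [sT dT leT]]]]; have [i hi] := deficit_half dT leT.
  exists (s i) => b; exists (half_box T i (e i (+) b)), s, e.
  by have [d1 d2] := hi (e i (+) b); split=> //; exact: sends_half.
- by have [T [s [e [sT leT]]]] := hP L LP; exists (deficit M T), T, s, e.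
- exists P' => // L /gP'[T [s [e [sT dT leT]]]]; exists T, s, e; split=> //.
  exact: deficit0.
Qed.

(** The targets of the boxes of a pattern, once they all have the same depth,
    are exactly the boxes of a grid: they cover the Cantor set because Phi is
    onto, without repetition because Phi is one-to-one. *)
Lemma sends_pattern P :  pattern P -> (forall L, L \in P -> exists T s e, sends L T s e) ->
  exists P' (T : dyadic_box n -> dyadic_box n) (s : dyadic_box n -> 'S_n)
    (e : dyadic_box n -> 'I_n -> bool), [/\ pattern P', pattern [seq T L | L <- P'] &
    forall L, L \in P' -> sends L (T L) (s L) (e L)].
Proof.
move=> pP hP.
have [M hM] : exists M, forall L, L \in P ->
    exists T s e, sends L T s e /\ forall i, (size (T i) <= M)%N.
  elim: P hP {pP} => [|L P IH] hP; first by exists 0%N.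
  have [|M hM] := IH; first by move=> L' LP; apply: hP; rewrite inE LP orbT.
  have [|T [s [e sT]]] := hP L; first by rewrite mem_head.
  exists (M + \sum_i size (T i))%N => L'; rewrite inE => /orP[/eqP->|/hM].
    exists T, s, e; split=> // i; apply: leq_trans (leq_addl _ _).
    by rewrite (bigD1 i)//= leq_addr.
  by move=> [T' [s' [e' [sT' h']]]]; exists T', s', e'; split=> // i;
    rewrite (leq_trans (h' i))// leq_addr.
have [P' pP' gP'] := sends_refine pP hM.
have ex L : exists Tse : dyadic_box n * 'S_n * ('I_n -> bool), L \in P' ->
    sends L Tse.1.1 Tse.1.2 Tse.2 /\ has_depth M Tse.1.1.
  have [LP|nLP] := boolP (L \in P'); last by exists ([ffun=> [::]], 1%g, fun=> false).
  by have [T [s [e h]]] := gP' L LP; exists (T, s, e).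
have [D hD] := choice ex.
exists P', (fun L => (D L).1.1), (fun L => (D L).1.2), (fun L => (D L).2).
split=> //; last by move=> L /hD[].
have [G pG gG] := @grid_pattern n M; apply: (pattern_renumber _ pG).
have C0 := @cantor_power0 R n lambda hl.
have cubeS s e y : Cn y -> unit_cube (signed_perm s e y).
  by move=> Cy; apply: unit_cube_signed_perm; exact: cantor_power_cube.
apply: uniq_perm; first exact: (pattern_uniq pG).
  rewrite map_inj_in_uniq; first exact: (pattern_uniq pP').
  move=> L L' LP LP' E; have [[_ sL] _] := hD L LP; have [[_ sL'] _] := hD L' LP'.
  set s := (D L).1.2 in sL; set e := (D L).2 in sL.
  set s' := (D L').1.2 in sL'; set e' := (D L').2 in sL'.
  pose y : 'rV[R]_n := signed_perm (s'^-1)%g (fun i => e' ((s'^-1)%g i)) (signed_perm s e 0).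
  have Cy : Cn y by do 2!apply: (signed_perm_cantor hl).
  apply: (pattern_disjoint pP' LP LP' (cantor_power_cube C0) (cantor_power_cube Cy)).
  by rewrite -[LHS]PhiK -[RHS]PhiK sL// sL'// E signed_permVK.
move=> U; apply/idP/mapP => [UG|[L LP ->]].
  have dU := gG U UG; have CU := cantor_power_box hl U C0.
  have [L [y [LP Cy E]]] := pattern_cover pP' (PsiC CU).
  exists L => //; have [[_ sL] dT] := hD L LP.
  apply: (box_map_eq_depth dU dT (cantor_power_cube C0) (cubeS (D L).1.2 (D L).2 y Cy)).
  by rewrite -sL// -E PsiK.
have [_ dT] := hD L LP; have CT := cantor_power_box hl (D L).1.1 C0.
have [V [y [VG Cy E]]] := pattern_cover pG CT.
suff -> : (D L).1.1 = V by [].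
by apply: (box_map_eq_depth dT (gG V VG) (cantor_power_cube C0) (cantor_power_cube Cy)).
Qed.

End PatternGeometry.

(** * Conjugation by the recoding homeomorphism *)

Section Transfer.
Context {R : realType} {n : nat} (lambda mu : R) (hl : 2 < lambda) (hm : 2 < mu).
Implicit Types (y : 'rV[R]_n) (L : dyadic_box n).

Definition recode_power (a b : R) y : 'rV[R]_n := \row_i recode a b (y ord0 i).

Lemma cantor_recode_power y : cantor_power mu n (recode_power lambda mu y).
Proof. by move=> i; rewrite mxE; exact: cantor_recode. Qed.

Lemma recode_powerK y : cantor_power lambda n y ->
  recode_power mu lambda (recode_power lambda mu y) = y.
Proof. by move=> Cy; apply/rowP => i; rewrite !mxE recodeK//; exact: Cy. Qed.

Lemma recode_box_map L y : cantor_power lambda n y ->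
  recode_power lambda mu (box_map lambda L y) = box_map mu L (recode_power lambda mu y).
Proof. by move=> Cy; apply/rowP => i; rewrite !mxE recode_phi_word//; exact: Cy. Qed.

Lemma recode_signed_perm s e y : cantor_power lambda n y ->
  recode_power lambda mu (signed_perm s e y) = signed_perm s e (recode_power lambda mu y).
Proof.
move=> Cy; apply/rowP => i; rewrite !mxE; case: (e i) => //=.
by rewrite recode_onem//; exact: Cy.
Qed.

Definition recode_point (x : cantor_power lambda n) : cantor_power mu n :=
  SigSub (mem_set (cantor_recode_power (val x))).

Lemma val_recode_point x : val (recode_point x) = recode_power lambda mu (val x).
Proof. by []. Qed.

End Transfer.

Section Groups.

Lemma isomorphic_by_conjugation (T U : Type) (G : set (T -> T)) (H : set (U -> U))
    (a : T -> U) (b : U -> T) : cancel a b -> cancel b a -> transformation_group G ->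
  (forall f, G f -> H (a \o (f \o b))) -> (forall g, H g -> G (b \o (g \o a))) ->
  isomorphic_groups G H.
Proof.
move=> aK bK gG GH HG; have [G1 GM GV] := gG.
have back g : a \o ((b \o (g \o a)) \o b) = g by apply/funext => u /=; rewrite !bK.
have forth f : b \o ((a \o (f \o b)) \o a) = f by apply/funext => u /=; rewrite !aK.
split=> //; last first.
  exists (fun f => a \o (f \o b)); split.
    split=> [f /GH//|f g _ _ E|g Hg]; first by rewrite -(forth f) -(forth g) E.
    by exists (b \o (g \o a)); [exact: HG|exact: back].
  by move=> f g _ _; apply/funext => u /=; rewrite aK.
split.
- by have := GH _ G1; rewrite (_ : a \o _ = idfun)//; apply/funext => u /=; rewrite bK.
- move=> f g Hf Hg; have := GH _ (GM _ _ (HG _ Hf) (HG _ Hg)).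
  by rewrite (_ : a \o _ = f \o g)//; apply/funext => u /=; rewrite !bK.
- move=> f Hf; have [g [Gg fK gK]] := GV _ (HG _ Hf); exists (a \o (g \o b)); split.
  + exact: GH.
  + by move=> u /=; have := fK (b u); rewrite /= bK => ->; rewrite bK.
  + by move=> u /=; have := gK (b u); rewrite /= => /(congr1 a); rewrite !bK.
Qed.

Lemma diff1p_group (R : realType) n (C : set 'rV[R]_n) : transformation_group (diff1p C).
Proof.
split.
- exists idfun; have [c o] := @diffeo_id R n; split=> //.
  by apply/seteqP; split=> [_ [x Cx <-]//|x Cx]; exists x.
- move=> f g [F [cF oF FC Ff]] [G [cG oG GC Gg]]; exists (F \o G).
  have [c o] := diffeo_comp (conj cF oF) (conj cG oG).
  split; [exact: c|exact: o| |by move=> x; rewrite /= Ff Gg].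
  by rewrite -[RHS]FC -[in RHS]GC image_comp.
- move=> f [F [cF oF FC Ff]].
  have [G [[cG oG] FK GK]] := diffeo_inv (conj cF oF).
  have GC x : C x -> C (G x) by rewrite -{1}FC => -[z Cz <-]; rewrite FK.
  have FC' x : C x -> C (F x) by move=> Cx; rewrite -FC; exists x.
  pose g (x : C) : C := SigSub (mem_set (GC _ (set_mem (valP x)))).
  exists g; split.
  + exists G; split; [exact: cG|exact: oG| |by []].
    apply/seteqP; split=> [_ [x Cx <-]|x Cx]; first exact: (GC x Cx).
    by exists (F x); [exact: FC'|exact: FK].
  + by move=> x; apply: val_inj; rewrite /= Ff FK.
  + by move=> x; apply: val_inj; rewrite Ff /= GK.
Qed.

End Groups.

Section Main.
Context {R : realType} {n : nat} (lambda : R) (hl : 2 < lambda) (hn : (1 < n)%N).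
Local Notation C := (cantor lambda).
Local Notation Cn := (@cantor_power R lambda n).

Lemma lam3 : 2 < 3 :> R. Proof. by lra. Qed.

Lemma cantor_valP (mu : R) (x : cantor_power mu n) : cantor_power mu n (val x).
Proof. exact: set_mem (valP x). Qed.

Lemma diff1p_data (f : Cn -> Cn) : diff1p Cn f -> exists Phi Psi,
  [/\ C1 Phi, C1 Psi, cancel Phi Psi & cancel Psi Phi] /\
  [/\ forall x, Cn x -> Cn (Phi x), forall x, Cn x -> Cn (Psi x),
      orientation_preserving Phi & forall x : Cn, val (f x) = Phi (val x)].
Proof.
move=> [Phi [[Psi [PhiK PsiK CPhi CPsi]] oPhi PhiC Ef]]; exists Phi, Psi.
have h1 x : Cn x -> Cn (Phi x) by move=> Cx; rewrite -PhiC; exists x.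
have h2 x : Cn x -> Cn (Psi x) by rewrite -{1}PhiC => -[z Cz <-]; rewrite PhiK.
by split; split.
Qed.

Lemma rigid_grid Phi m (P : seq (dyadic_box n)) :
  (forall W : dyadic_box n, has_depth m W -> rigid lambda Phi W) ->
  (forall L, L \in P -> has_depth m L) ->
  forall L, L \in P -> exists T s e, sends lambda Phi L T s e.
Proof.
by move=> h gP L /gP/h[T [s [e [ev E]]]]; exists T, s, e.
Qed.

(** The digit preserving map intertwines the affine parametrizations of boxes and
    commutes with the symmetries of the cube, so it transports the rigid form
    of a diffeomorphism to an element of nV^sym, and conversely. *)
Lemma diff1p_nVsym (f : Cn -> Cn) : diff1p Cn f ->
  nVsym R n (@recode_point R n lambda 3 lam3 \o (f \o @recode_point R n 3 lambda hl)).
Proof.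
move=> /diff1p_data[Phi [Psi [[CPhi CPsi PhiK PsiK] [PhiC PsiC oPhi Ef]]]].
have [m hm] := rigid_uniform hl CPhi CPsi PhiK PsiK PhiC PsiC oPhi.
have [G pG gG] := @grid_pattern n m.
have [P [T [s [e [pP pQ hP]]]]] := sends_pattern hl hn PhiK PsiK PsiC pG (rigid_grid hm gG).
exists (size P), (in_tuple P), (map_tuple T (in_tuple P)).
exists (fun i => let L := tnth (in_tuple P) i in signed_perm (s L) (e L)); split=> //.
  by move=> i; apply: cube_symmetry_signed_perm; have [] := hP _ (mem_tnth i (in_tuple P)).
move=> i x y Exy; set L := tnth (in_tuple P) i in Exy *.
have [_ hL] := hP L (mem_tnth i (in_tuple P)).
have Cy := cantor_valP y; have Cy' := @cantor_recode_power R n 3 lambda hl (val y).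
rewrite tnth_map -/L val_recode_point Ef val_recode_point Exy.
rewrite -[alpha L (val y)]/(box_map 3 L (val y)).
rewrite (recode_box_map lam3 hl)// hL// (recode_box_map hl lam3); last exact: (signed_perm_cantor hl).
by rewrite (recode_signed_perm hl lam3)// (recode_powerK lam3 hl).
Qed.

Lemma nVsym_diff1p (g : @triadic_power R n -> @triadic_power R n) : nVsym R n g ->
  diff1p Cn (@recode_point R n 3 lambda hl \o (g \o @recode_point R n lambda 3 lam3)).
Proof.
move=> [N [P [Q [S [pP pQ hS hg]]]]].
have [F [cF oF] hF] := pattern_realize hl hn pP pQ hS.
have [s hs] := choice (fun i => cube_symmetryP (hS i)).
have [e hse] := choice hs.
have SE i : S i = signed_perm (s i) (e i) by case: (hse i).
have hF' i y : Cn y ->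
    F (box_map lambda (tnth P i) y) = box_map lambda (tnth Q i) (signed_perm (s i) (e i) y).
  by move=> Cy; rewrite hF ?SE//; exact: (cantor_power_cube hl).
have coverP x : Cn x -> exists i y, Cn y /\ x = box_map lambda (tnth P i) y.
  move=> /(pattern_cover hl pP)[L [y [/tnthP[i ->] Cy ->]]]; by exists i, y.
have coverQ x : Cn x -> exists i y, Cn y /\ x = box_map lambda (tnth Q i) y.
  move=> /(pattern_cover hl pQ)[L [y [/tnthP[i ->] Cy ->]]]; by exists i, y.
exists F; split; [exact: cF|exact: oF| |].
- apply/seteqP; split=> [_ [x Cx <-]|z Cz].
    have [i [y [Cy ->]]] := coverP x Cx; rewrite hF'//.
    by apply: (cantor_power_box hl); exact: (signed_perm_cantor hl).
  have [i [y [Cy ->]]] := coverQ z Cz.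
  pose y' : 'rV[R]_n := signed_perm ((s i)^-1)%g (fun k => e i (((s i)^-1)%g k)) y.
  have Cy' : Cn y' by exact: (signed_perm_cantor hl).
  exists (box_map lambda (tnth P i) y'); first exact: (cantor_power_box hl).
  by rewrite hF'// signed_permVK.
move=> x; have [i [y [Cy E]]] := coverP _ (cantor_valP x).
pose z : Cn := SigSub (mem_set Cy); pose u := @recode_point R n lambda 3 lam3 z.
have Eu : val (@recode_point R n lambda 3 lam3 x) = alpha (tnth P i) (val u).
  by rewrite val_recode_point E (recode_box_map hl lam3).
rewrite [LHS]val_recode_point (hg i _ u Eu) SE E hF'//.
rewrite -[alpha _ _]/(box_map 3 (tnth Q i) (signed_perm (s i) (e i) (recode_power lambda 3 y))).
have Cu := @cantor_recode_power R n lambda 3 lam3 y.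
rewrite (recode_box_map lam3 hl); last exact: (signed_perm_cantor lam3).
by rewrite (recode_signed_perm lam3 hl)// (recode_powerK hl lam3).
Qed.

Lemma diff1p_isomorphic : isomorphic_groups (diff1p Cn) (nVsym R n).
Proof.
apply: (@isomorphic_by_conjugation _ _ _ _ (@recode_point R n lambda 3 lam3)
    (@recode_point R n 3 lambda hl)).
- move=> x; apply: val_inj; rewrite !val_recode_point.
  by rewrite (recode_powerK hl lam3)//; exact: cantor_valP.
- move=> x; apply: val_inj; rewrite !val_recode_point.
  by rewrite (recode_powerK lam3 hl)//; exact: cantor_valP.
- exact: diff1p_group.
- exact: diff1p_nVsym.
- exact: nVsym_diff1p.
Qed.

Definition word_box (L : dyadic_box n) : set 'rV[R]_n :=
  box (fun i => phi_word lambda (L i) @` [set` `[0, 1]]).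

Lemma word_box_map L x : word_box L x -> exists2 y, unit_cube y & x = box_map lambda L y.
Proof.
move=> hx; have [t ht] := choice (fun i => let: ex_intro2 t a b := hx i in ex_intro _ t (conj a b)).
exists (\row_i t i); first by move=> i; rewrite mxE; case: (ht i).
by apply/rowP => i; rewrite !mxE; case: (ht i).
Qed.

Lemma diff1p_local_form (f : Cn -> Cn) : diff1p Cn f ->
  exists (N : nat) (I : 'I_N -> set 'rV[R]_n)
         (k : 'I_N -> 'I_n -> int) (a b : 'I_N -> 'I_n -> R)
         (S : 'I_N -> 'rV[R]_n -> 'rV[R]_n),
    [/\ forall j, standard_parallelepiped lambda (I j),
        trivIset setT I,
        Cn `<=` \bigcup_j I j,
        forall j i, C (a j i) /\ C (b j i) &
        (forall j, cube_symmetry (S j)) /\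
        forall j (x : Cn), I j (val x) ->
          val (f x) = \row_i (b j i + lambda ^ k j i * (S j (val x) ord0 i - a j i))].
Proof.
move=> /diff1p_data[Phi [Psi [[CPhi CPsi PhiK PsiK] [PhiC PsiC oPhi Ef]]]].
have [m hm] := rigid_uniform hl CPhi CPsi PhiK PsiK PhiC PsiC oPhi.
have [P pP dP] := @grid_pattern n m.
pose W (j : 'I_(size P)) := tnth (in_tuple P) j.
have dW j : has_depth m (W j) by apply: dP; exact: (mem_tnth j (in_tuple P)).
have [T hT] := choice (fun j => hm _ (dW j)).
have [s hs] := choice hT; have [e hE] := choice hs.
have C0 := cantor0 hl.
(* The word of the interval that contains the i-th coordinate of S x. *)
pose w j i := if e j i then map negb (W j (s j i)) else W j (s j i).
have sw j i : size (w j i) = m by rewrite /w; case: ifP => _; rewrite ?size_map dW.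
exists (size P), (fun j => word_box (W j)), (fun j i => m%:Z - (size (T j i))%:Z),
  (fun j i => phi_word lambda (w j i) 0), (fun j i => phi_word lambda (T j i) 0),
  (fun j => signed_perm (s j) (e j)); split.
- move=> j; exists (fun i => phi_word lambda (W j i) @` [set` `[0, 1]]); split=> // i.
  by exists (W j i).
- apply/trivIsetP => j j' _ _ jj'; apply/seteqP; split=> // x [].
  move=> /word_box_map[y cy ->] /word_box_map[y' cy' E].
  have EW : W j = W j' by exact: (box_map_eq_depth hl (dW j) (dW j') cy cy' E).
  move: jj'; suff -> : j = j' by rewrite eqxx.
  apply: val_inj; apply/eqP.
  rewrite -(nth_uniq [ffun=> [::]] (ltn_ord j) (ltn_ord j') (pattern_uniq hl hn pP)).
  by apply/eqP; move: EW; rewrite /W !(tnth_nth [ffun=> [::]]).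
- move=> x /(pattern_cover hl pP)[L [y [LP Cy ->]]].
  have /tnthP[j EL] : L \in in_tuple P by [].
  exists j => // i; rewrite mxE EL; exists (y ord0 i) => //.
  by rewrite /= in_itv; exact: (cantor_I hl (Cy i)).
- by move=> j i; split; exact: (cantor_word hl _ C0).
- split=> [j|j x]; first by apply: cube_symmetry_signed_perm; case: (hE j).
  move=> /word_box_map[y cy Ex].
  have Cx := cantor_valP x; have [W' [y' [dW' Cy' Ex']]] := cantor_power_depth hl m Cx.
  have EW : W' = W j.
    apply: (box_map_eq_depth hl dW' (dW j) (cantor_power_cube hl Cy') cy).
    by rewrite -Ex' -Ex.
  rewrite EW in Ex'; have [_ hj] := hE j.
  rewrite Ef Ex' hj//; apply/rowP => i; rewrite [LHS]mxE [RHS]mxE !signed_permE.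
  have -> : flip (e j i) ((box_map lambda (W j) y') ord0 (s j i)) =
      phi_word lambda (w j i) (flip (e j i) (y' ord0 (s j i))).
    by rewrite mxE /w; case: (e j i) => //=; rewrite (phi_word_onem hl).
  set z := flip _ _; rewrite (phi_wordB hl) sw subr0 (phi_wordE hl) addrC; congr (_ + _).
  have l0 := lam_neq0 hl.
  have -> : lambda ^ (m%:Z - (size (T j i))%:Z) = lambda ^+ m * lambda^-1 ^+ size (T j i).
    by rewrite expfzDr// -exprnP -exprnN exprVn.
  by rewrite mulrACA -exprMn mulfV// expr1n mul1r.
Qed.

End Main.

Theorem theorem7 (R : realType) (n : nat) (lambda : R)
    (hn : (2 <= n)%N) (hlambda : 2 < lambda) :
  (forall varphi : cantor_power lambda n -> cantor_power lambda n,
     diff1p (cantor_power lambda n) varphi ->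
     exists (N : nat) (I : 'I_N -> set 'rV[R]_n)
            (k : 'I_N -> 'I_n -> int) (a b : 'I_N -> 'I_n -> R)
            (S : 'I_N -> 'rV[R]_n -> 'rV[R]_n),
       [/\ forall j, standard_parallelepiped lambda (I j),
           trivIset setT I,
           cantor_power lambda n `<=` \bigcup_j I j,
           forall j i, cantor lambda (a j i) /\ cantor lambda (b j i) &
           (forall j, cube_symmetry (S j)) /\
           forall j (x : cantor_power lambda n), I j (val x) ->
             val (varphi x) =
               \row_i (b j i + lambda ^ k j i * (S j (val x) ord0 i - a j i))])
  /\ isomorphic_groups (diff1p (cantor_power lambda n)) (nVsym R n).
Proof.
split; last exact: diff1p_isomorphic.
by move=> f; exact: diff1p_local_form.
Qed.
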